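(* Let $n\ge 2$ be an integer and $\rho=(n-1,\ldots,1)$. For any partition $\lambda\subseteq\rho$, let $\mu=\lambda'$ be the conjugate partition and let $$(\rho/\lambda)=[0,\,n-1-\mu_1,\,0,\,n-2-\mu_2,\,0,\,n-3-\mu_3,\,0,\ldots].$$ Let $$N(t_0,\ldots,t_{n-1})=\mathrm{CT}\left(\prod_{1\le i<j\le n}\frac{(x_j-x_i)(1+t_ix_j)}{1-x_ix_j}\prod_{i=1}^n\frac{1+t_0x_i}{1-x_i^2}\prod_{i=1}^n x_i^{-2i+2}\right).$$ Then $$N(t_0,\ldots,t_{n-1})=\sum_{\lambda\subseteq\rho,\ \lambda\text{ even}}Y_{(\rho/\lambda)}(\bar{\mathbf y},\mathbf 0),$$ where the alphabet $\bar{\mathbf y}$ is specialised to $\{t_0,t_1,0,t_2,0,t_3,0,\ldots\}$.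
   Context: $\mathrm{CT}$ denotes the constant term with respect to all variables $x_1,\ldots,x_n$, with all factors $(1-x_ix_j)^{-1}$ and $(1-x_i^2)^{-1}$ expanded as power series in the $x$'s. $t_0,\ldots,t_{n-1}$ are indeterminates. A partition is called even if all its parts are even (the empty partition is even). The index $(\rho/\lambda)$ has entry $n-k-\mu_k$ in position $2k$ for $1\le k\le n-1$ (with $\mu_k=0$ beyond the length of $\mu$) and $0$ in all other positions. Schubert polynomials. For $v\in\mathbb{N}^m$ and alphabets $\mathbf x=\{x_1,\ldots,x_m\}$, $\mathbf y=\{y_1,y_2,\ldots\}$, the Schubert polynomials $Y_v(\mathbf x,\mathbf y)$ are defined recursively: if $v=\lambda$ is a partition ($\lambda_1\ge\cdots\ge\lambda_m\ge0$), $Y_\lambda(\mathbf x,\mathbf y)=\prod_{i=1}^m\prod_{j=1}^{\lambda_i}(x_i-y_j)$; and whenever $v_i>v_{i+1}$, $\partial_iY_v(\mathbf x,\mathbf y)=Y_{[\ldots,v_{i-1},v_{i+1},v_i-1,v_{i+2},\ldots]}(\mathbf x,\mathbf y)$, where $\partial_if=\frac{f-s_if}{x_i-x_{i+1}}$ and $s_i$ exchanges $x_i$ and $x_{i+1}$. (Appending zeros to $v$ does not change $Y_v$.) $Y_v(\bar{\mathbf y},\mathbf 0)$ means the first alphabet is $\bar{\mathbf y}$, i.e. $x_k$ is replaced by the $k$-th letter of $\bar{\mathbf y}=\{t_0,t_1,0,t_2,0,t_3,\ldots\}$ (letter $1$ is $t_0$, letter $2k$ is $t_k$, letter $2k+1$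 is $0$ for $k\ge1$), and all letters of the second alphabet are $0$. *)

(* Defs.v *)
From HB Require Import structures.
From mathcomp Require Import all_boot all_order all_algebra all_fingroup.
From mathcomp Require Import mpoly.
From mathcomp Require Import boolp.
From mathcomp Require Import ring zify.

Set Implicit Arguments.
Unset Strict Implicit.
Unset Printing Implicit Defensive.

Import GRing.Theory.
Local Open Scope ring_scope.

(* Formal power series in n commuting variables with coefficients in R; the
   record is given its Cauchy-product ring structure below. *)
Record fps (n : nat) (R : Type) := Fps { fcoef : 'X_{1..n} -> R }.
Add Printing Constructor fps.

HB.instance Definition _ n R := gen_eqMixin (fps n R).
HB.instance Definition _ n R := gen_choiceMixin (fps n R).

Lemma fps_eq n R (f g : fps n R) : fcoef f =1 fcoef g -> f = g.
Proof. by case: f g => [f] [g] /= /funext ->. Qed.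

Section FpsRing.
Variables (n : nat) (R : comNzRingType).
Implicit Types (f g h : fps n R) (m : 'X_{1..n}).

Definition fps_const (a : R) : fps n R := Fps (fun m => if m == 0%MM then a else 0).
Definition fps_var (i : 'I_n) : fps n R := Fps (fun m => (m == U_(i)%MM)%:R).
Definition fps_add f g : fps n R := Fps (fun m => fcoef f m + fcoef g m).
Definition fps_opp f : fps n R := Fps (fun m => - fcoef f m).
Definition fps_mul f g : fps n R :=
  Fps (fun m => \sum_(k : 'X_{1..n < (mdeg m).+1, (mdeg m).+1} | m == (k.1 + k.2)%MM)
                  fcoef f k.1 * fcoef g k.2).

Let trunc d f : {mpoly R[n]} := \sum_(m : 'X_{1..n < d.+1}) fcoef f m *: 'X_[m].

Let truncE d f m : (mdeg m <= d)%N -> (trunc d f)@_m = fcoef f m.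
Proof. by move=> le_md; rewrite (mcoeff_mpoly (fun m => fcoef f m)). Qed.

Let fps_mulE d f g m : (mdeg m <= d)%N ->
  fcoef (fps_mul f g) m = (trunc d f * trunc d g)@_m.
Proof.
move=> le_md; rewrite mcoeffM; apply: eq_bigr => -[[k Hk] [l Hl]] _ /=.
by rewrite !truncE // -ltnS; [apply: leq_trans Hl _ | apply: leq_trans Hk _].
Qed.

Let fps_addA : associative fps_add.
Proof. by move=> f g h; apply: fps_eq => m /=; rewrite addrA. Qed.
Let fps_addC : commutative fps_add.
Proof. by move=> f g; apply: fps_eq => m /=; rewrite addrC. Qed.
Let fps_add0 : left_id (fps_const 0) fps_add.
Proof. by move=> f; apply: fps_eq => m /=; rewrite if_same add0r. Qed.
Let fps_addN : left_inverse (fps_const 0) fps_opp fps_add.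
Proof. by move=> f; apply: fps_eq => m /=; rewrite if_same addNr. Qed.

HB.instance Definition _ :=
  GRing.isZmodule.Build (fps n R) fps_addA fps_addC fps_add0 fps_addN.

Let fps_mulA : associative fps_mul.
Proof.
move=> f g h; apply: fps_eq => m; rewrite !(@fps_mulE (mdeg m)) //.
transitivity ((trunc (mdeg m) f * (trunc (mdeg m) g * trunc (mdeg m) h))@_m).
  rewrite !mcoeffM; apply: eq_bigr => -[[k Hk] [l Hl]] _ /=.
  by rewrite truncE // -(@fps_mulE (mdeg m)) // truncE.
rewrite mulrA !mcoeffM; apply: eq_bigr => -[[k Hk] [l Hl]] _ /=.
by rewrite -fps_mulE // !truncE.
Qed.
Let fps_mulC : commutative fps_mul.
Proof.
by move=> f g; apply: fps_eq => m; rewrite !(@fps_mulE (mdeg m)) // mulrC.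
Qed.
Let fps_mul1 : left_id (fps_const 1) fps_mul.
Proof.
move=> f; apply: fps_eq => m; rewrite (@fps_mulE (mdeg m)) //.
suff ->: trunc (mdeg m) (fps_const 1) = 1 by rewrite mul1r truncE.
apply/mpolyP => k; rewrite mcoeff1 /trunc.
under eq_bigr do rewrite /= fun_if if_arg scale1r scale0r.
have H0 : (mdeg (0%MM : 'X_{1..n}) < (mdeg m).+1)%N by rewrite mdeg0.
rewrite -big_mkcond (big_pred1 (BMultinom H0)) /=; last by move=> i; rewrite -val_eqE.
by rewrite mcoeffX eq_sym.
Qed.
Let fps_mulDl : left_distributive fps_mul fps_add.
Proof.
move=> f g h; apply: fps_eq => m /=; rewrite -big_split /=.
by apply: eq_bigr => k _; rewrite mulrDl.
Qed.
Let fps_neq0 : fps_const 1 != 0.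
Proof.
apply/eqP => /(congr1 (fun f => fcoef f 0%MM)) /= /eqP.
by rewrite eqxx oner_eq0.
Qed.

HB.instance Definition _ := GRing.Zmodule_isComNzRing.Build (fps n R)
  fps_mulA fps_mulC fps_mul1 fps_mulDl fps_neq0.

Lemma fcoefM f g m :
  fcoef (f * g) m =
  \sum_(k : 'X_{1..n < (mdeg m).+1, (mdeg m).+1} | m == (k.1 + k.2)%MM)
     fcoef f k.1 * fcoef g k.2.
Proof. by []. Qed.

Lemma fcoef0 m : fcoef (0 : fps n R) m = 0.
Proof. exact: if_same. Qed.

Lemma fcoef1 m : fcoef (1 : fps n R) m = (m == 0%MM)%:R.
Proof. by rewrite /= ; case: eqP. Qed.

Lemma fcoefD f g m : fcoef (f + g) m = fcoef f m + fcoef g m.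
Proof. by []. Qed.

Lemma fcoefN f m : fcoef (- f) m = - fcoef f m.
Proof. by []. Qed.

Lemma fcoef_sum (I : Type) (r : seq I) (P : pred I) (F : I -> fps n R) m :
  fcoef (\sum_(i <- r | P i) F i) m = \sum_(i <- r | P i) fcoef (F i) m.
Proof.
by elim/big_rec2: _ => [|i x y _ <-]; rewrite ?fcoef0 ?fcoefD.
Qed.

Lemma fcoefM0 f g : fcoef (f * g) 0%MM = fcoef f 0%MM * fcoef g 0%MM.
Proof.
by rewrite (@fps_mulE 0) ?mdeg0 // rmorphM /= !truncE ?mdeg0.
Qed.

Lemma fcoefX_eq0 f k m :
  fcoef f 0%MM = 0 -> (mdeg m < k)%N -> fcoef (f ^+ k) m = 0.
Proof.
move=> f0; elim: k m => // k IHk m lt_mk.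
rewrite exprS fcoefM big1 // => -[[a Ha] [b Hb]] /= /eqP def_m.
have [->|nz_a] := eqVneq a 0%MM; first by rewrite f0 mul0r.
rewrite IHk ?mulr0 // -ltnS (leq_trans _ lt_mk) // ltnS def_m mdegD.
by rewrite -add1n leq_add2r lt0n mdeg_eq0.
Qed.

Lemma eq_fcoefM d f f' g :
    (forall m, (mdeg m <= d)%N -> fcoef f m = fcoef f' m) ->
  forall m, (mdeg m <= d)%N -> fcoef (f * g) m = fcoef (f' * g) m.
Proof.
move=> eqf m le_md; rewrite !fcoefM; apply: eq_bigr => -[[a Ha] [b Hb]] _ /=.
by rewrite eqf // (leq_trans _ le_md).
Qed.

End FpsRing.

Section FpsUnit.
Variables (n : nat) (R : comUnitRingType).
Implicit Types (f g h : fps n R) (m : 'X_{1..n}).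

(* The k-th power only contributes in degrees >= k when f has no constant
   term, which is why the sum can be truncated. *)
Definition fps_geom f : fps n R :=
  Fps (fun m => \sum_(k < (mdeg m).+1) fcoef (f ^+ k) m).

Lemma fps_geomP f : fcoef f 0%MM = 0 -> fps_geom f * (1 - f) = 1.
Proof.
move=> f0; apply: fps_eq => m; set d := mdeg m.
rewrite (@eq_fcoefM _ _ d _ (\sum_(k < d.+1) f ^+ k)) //.
  rewrite mulrC -opprB mulNr -subrX1 opprB fcoefD fcoefN fcoefX_eq0 //.
  by rewrite subr0.
move=> k le_kd; rewrite fcoef_sum /= -!(big_mkord xpredT (fun i => fcoef (f ^+ i) k)).
rewrite [RHS](big_cat_nat (n := (mdeg k).+1)) //= [X in _ = _ + X]big_nat_cond [X in _ = _ + X]big1 ?addr0 //.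
by move=> i; rewrite andbT => /andP[lt_ki _]; rewrite fcoefX_eq0.
Qed.

(* A power series is a unit iff its constant term is; the inverse is the
   expansion 1 / f = c * \sum_k (1 - c f)^k with c = 1 / f(0).  In particular
   (1 - 'x_i * 'x_j)^-1 is the usual geometric series. *)
Definition fps_unit : pred (fps n R) := fun f => fcoef f 0%MM \is a GRing.unit.

Definition fps_inv f : fps n R :=
  if f \in fps_unit then
    let c := fps_const n (fcoef f 0%MM)^-1 in fps_geom (1 - c * f) * c
  else f.

Let fps_mulVf : {in fps_unit, left_inverse 1 fps_inv *%R}.
Proof.
move=> f; rewrite /fps_inv => Uf; rewrite Uf -mulrA.
set c := fps_const _ _.
rewrite -[X in _ * X](subKr 1) fps_geomP // fcoefD fcoefN fcoefM0 fcoef1 /= eqxx.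
by rewrite mulVr ?subrr.
Qed.

Let fps_unitP f g : g * f = 1 -> fps_unit f.
Proof.
move=> /(congr1 (fun h => fcoef h 0%MM)); rewrite /fps_unit fcoefM0 fcoef1 eqxx => gf1.
by apply/unitrPr; exists (fcoef g 0%MM); rewrite mulrC.
Qed.

Let fps_inv_out : {in [predC fps_unit], fps_inv =1 id}.
Proof. by move=> f /negPf; rewrite /fps_inv => ->. Qed.

HB.instance Definition _ := GRing.ComNzRing_hasMulInverse.Build (fps n R)
  fps_mulVf fps_unitP fps_inv_out.

Lemma fps_unitrE f : (f \is a GRing.unit) = (fcoef f 0%MM \is a GRing.unit).
Proof. by []. Qed.

End FpsUnit.

Section Laurent.
Variables (n : nat) (R : nmodType).

(* Coefficient functions of formal Laurent series: e is the exponent vector. *)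
Definition laurent := {ffun 'I_n -> int} -> R.

Definition laurent_of_fps (f : fps n R) : laurent := fun e =>
  if [forall i, 0 <= e i] then fcoef f [multinom `|e i|%N | i < n] else 0.

(* Multiplication of F by the Laurent monomial \prod_i x_i^(a i). *)
Definition laurent_shift (a : {ffun 'I_n -> int}) (F : laurent) : laurent :=
  fun e => F (e - a).

Definition CT (F : laurent) : R := F 0.

End Laurent.

Section DividedDifference.
Variables (m : nat) (R : idomainType).
Implicit Types (i j k l : 'I_m) (f g : {mpoly R[m]}).

(* The operator exchanging the variables 'X_i and 'X_j. *)
Definition xswap i j f : {mpoly R[m]} := msym (tperm i j) f.

Lemma xswapX i j l : xswap i j 'X_l = 'X_(tperm i j l).
Proof. by rewrite /xswap /msym mmapX mmap1U. Qed.

Lemma ddiff_subproof i j f :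
  exists q : {mpoly R[m]}, q * ('X_i - 'X_j) == f - xswap i j f.
Proof.
rewrite /xswap; elim/mpolyind: f => [|c u f _ _ [q /eqP Hq]].
  by exists 0; rewrite msym0 subr0 mul0r.
suff [p /eqP Hp]: exists p : {mpoly R[m]},
    p * ('X_i - 'X_j) == 'X_[u] - msym (tperm i j) 'X_[u].
  exists (c *: p + q); rewrite mulrDl -scalerAl Hp Hq msymD msymZ scalerBr.
  by apply/eqP; ring.
rewrite (mpolyXE_id R u).
elim/big_rec: _ => [|l x _ [p /eqP Hp]].
  by exists 0; rewrite rmorph1 subrr mul0r.
suff [r /eqP Hr]: exists r : {mpoly R[m]},
    r * ('X_i - 'X_j) == 'X_l ^+ u l - msym (tperm i j) ('X_l ^+ u l).
  exists (r * x + msym (tperm i j) ('X_l ^+ u l) * p); apply/eqP.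
  rewrite mulrDl mulrAC Hr -mulrA Hp msymM; ring.
rewrite rmorphXn /=.
rewrite -[msym _ _]/(xswap i j 'X_l) xswapX subrXX; case: tpermP => [->|->|_ _].
- by exists (\sum_(k < u i) 'X_i ^+ ((u i).-1 - k) * 'X_j ^+ k); rewrite mulrC.
- exists (- \sum_(k < u j) 'X_j ^+ ((u j).-1 - k) * 'X_i ^+ k).
  by rewrite mulNr mulrC -mulNr opprB.
- by exists 0; rewrite subrr !mul0r.
Qed.

(* The divided difference (f - s f) / ('X_i - 'X_j), i.e. the quotient provided
   by ddiff_subproof; it is unique for i != j (ddiff_uniq). *)
Definition ddiff i j f : {mpoly R[m]} := xchoose (ddiff_subproof i j f).

Lemma ddiffP i j f : ddiff i j f * ('X_i - 'X_j) = f - xswap i j f.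
Proof. exact/eqP/(xchooseP (ddiff_subproof i j f)). Qed.

Lemma subX_neq0 i j : i != j -> 'X_i - 'X_j != 0 :> {mpoly R[m]}.
Proof.
move=> neq_ij; apply/eqP => /(congr1 (mcoeff U_(i)%MM)) /eqP.
rewrite mcoeffB !mcoeffX mcoeff0 eqxx.
have /negPf -> : U_(j)%MM != U_(i)%MM :> 'X_{1..m}.
  apply/eqP => /(congr1 (fun u : 'X_{1..m} => u i)) /eqP.
  by rewrite !mnm1E eqxx (eq_sym j) (negPf neq_ij).
by rewrite subr0 oner_eq0.
Qed.

Lemma ddiff_uniq i j f q :
  i != j -> q * ('X_i - 'X_j) = f - xswap i j f -> ddiff i j f = q.
Proof.
move=> neq_ij Hq; apply: (mulIf (subX_neq0 neq_ij)).
by rewrite ddiffP Hq.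
Qed.

Lemma xswapM i j f g : xswap i j (f * g) = xswap i j f * xswap i j g.
Proof. exact: msymM. Qed.
Lemma xswapB i j f g : xswap i j (f - g) = xswap i j f - xswap i j g.
Proof. exact: msymB. Qed.
Lemma xswapK i j f : xswap i j (xswap i j f) = f.
Proof. by rewrite /xswap -msymMm tperm2 msym1m. Qed.

Lemma ddiffC i j k l f :
    i != j -> k != l -> i != k -> i != l -> j != k -> j != l ->
  ddiff k l (ddiff i j f) = ddiff i j (ddiff k l f).
Proof.
have aux i' j' k' l' : i' != j' -> k' != l' -> i' != k' -> i' != l' -> j' != k' ->
    j' != l' -> ddiff k' l' (ddiff i' j' f) * (('X_i' - 'X_j') * ('X_k' - 'X_l')) =
    f - xswap i' j' f - xswap k' l' f + xswap k' l' (xswap i' j' f).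
  move=> ij kl ik il jk jl; set g := ddiff i' j' f; set h := ddiff k' l' g.
  have Hs : xswap k' l' ('X_i' - 'X_j') = 'X_i' - 'X_j' :> {mpoly R[m]}.
    by rewrite xswapB !xswapX !tpermD // eq_sym.
  rewrite mulrC -mulrA (mulrC _ h) ddiffP mulrC mulrBl -{2}Hs -xswapM ddiffP xswapB.
  by move: (xswap k' l' (xswap i' j' f)) (xswap i' j' f) (xswap k' l' f) => p q r; ring.
move=> ij kl ik il jk jl.
have E1 := aux i j k l ij kl ik il jk jl.
rewrite eq_sym in ik; rewrite eq_sym in il; rewrite eq_sym in jk; rewrite eq_sym in jl.
have := aux k l i j kl ij ik jk il jl.
rewrite (mulrC ('X_k - 'X_l)).
have -> : xswap i j (xswap k l f) = xswap k l (xswap i j f).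
  rewrite /xswap -!msymMm; congr (msym _ f).
  by rewrite conjgC tpermJ !tpermD // eq_sym.
move=> E2; apply: (mulIf (mulf_neq0 (subX_neq0 ij) (subX_neq0 kl))).
apply: (etrans E1); apply: etrans (esym E2).
by move: (xswap k l (xswap i j f)) (xswap i j f) (xswap k l f) => p q r; ring.
Qed.

Lemma ddiff_braid i j k f : i != j -> j != k -> i != k ->
  ddiff i j (ddiff j k (ddiff i j f)) = ddiff j k (ddiff i j (ddiff j k f)).
Proof.
move=> ij jk ik.
have aux (s t : {mpoly R[m]} -> {mpoly R[m]}) (A B C g h l : {mpoly R[m]}) :
    {morph s : x y / x * y} -> {morph t : x y / x * y} ->
    {morph s : x y / x - y} -> {morph t : x y / x - y} ->
    s (s f) = f -> A != 0 -> A + B = C ->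
    s A = - A -> s B = C -> s C = B -> t A = C -> t C = A ->
    g * A = f - s f -> h * B = g - t g -> l * A = h - s h ->
  l * (A * B * C) = f - s f - t f + s (t f) + t (s f) - s (t (s f)).
  move=> sM tM sB tB sK nzA ABC sA sBC sC tA tC Hg Hh Hl.
  have sg : s g = g.
    apply: (mulIf nzA); apply: (can_inj (@opprK _)).
    by rewrite Hg -mulrN -sA -sM Hg sB sK opprB.
  have Hsh : s h * C = g - s (t g) by rewrite -sBC -sM Hh sB sg.
  have Htg : t g * C = t f - t (s f) by rewrite -tA -tM Hg tB.
  have Hstg : s (t g) * B = s (t f) - s (t (s f)).
    by rewrite -sC -sM Htg sB.
  have -> : l * (A * B * C) = (l * A) * B * C by ring.
  rewrite Hl.
  have -> : (h - s h) * B * C = (h * B) * C - (s h * C) * B by ring.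
  rewrite Hh Hsh.
  have -> : (g - t g) * C - (g - s (t g)) * B = g * (C - B) - t g * C + s (t g) * B.
    by ring.
  by rewrite Htg Hstg -ABC addrK Hg; ring.
pose s := xswap i j : {mpoly R[m]} -> _; pose t := xswap j k : {mpoly R[m]} -> _.
have neq := (eq_sym j i, eq_sym k j, eq_sym k i).
have AB : ('X_i - 'X_j) + ('X_j - 'X_k) = 'X_i - 'X_k :> {mpoly R[m]} by ring.
have BA : ('X_j - 'X_k) + ('X_i - 'X_j) = 'X_i - 'X_k :> {mpoly R[m]} by ring.
have sA : s ('X_i - 'X_j) = - ('X_i - 'X_j) :> {mpoly R[m]}.
  by rewrite /s xswapB !xswapX tpermL tpermR opprB.
have sB : s ('X_j - 'X_k) = 'X_i - 'X_k :> {mpoly R[m]}.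
  by rewrite /s xswapB !xswapX tpermR tpermD ?neq.
have sC : s ('X_i - 'X_k) = 'X_j - 'X_k :> {mpoly R[m]}.
  by rewrite /s xswapB !xswapX tpermL tpermD ?neq.
have tA : t ('X_i - 'X_j) = 'X_i - 'X_k :> {mpoly R[m]}.
  by rewrite /t xswapB !xswapX tpermL tpermD ?neq.
have tB : t ('X_j - 'X_k) = - ('X_j - 'X_k) :> {mpoly R[m]}.
  by rewrite /t xswapB !xswapX tpermL tpermR opprB.
have tC : t ('X_i - 'X_k) = 'X_i - 'X_j :> {mpoly R[m]}.
  by rewrite /t xswapB !xswapX tpermR tpermD ?neq.
have nzA := subX_neq0 ij; have nzB := subX_neq0 jk; have nzC := subX_neq0 ik.
apply: (mulIf (mulf_neq0 (mulf_neq0 nzA nzB) nzC)).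
have E1 := aux s t _ _ _ _ _ _ (xswapM i j) (xswapM j k)
  (xswapB i j) (xswapB j k) (xswapK i j f) nzA AB sA sB sC tA tC
  (ddiffP _ _ _) (ddiffP _ _ _) (ddiffP _ _ _).
have := aux t s _ _ _ _ _ _ (xswapM j k) (xswapM i j)
  (xswapB j k) (xswapB i j) (xswapK j k f) nzB BA tB tA tC sB sC
  (ddiffP _ _ _) (ddiffP _ _ _) (ddiffP _ _ _).
rewrite (mulrC ('X_j - 'X_k)).
have -> : t (s (t f)) = s (t (s f)).
  rewrite /t /s /xswap -!msymMm; congr (msym _ f).
  have := tpermJ j k (tperm i j); rewrite tpermR (tpermD ik jk) /conjg tpermV.
  have := tpermJ i j (tperm j k); rewrite tpermL tpermD ?neq // /conjg tpermV.
  by rewrite !mulgA => -> ->.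
move=> E2; apply: (etrans E1); apply: etrans (esym E2).
by move: (s (t (s f))) (s (t f)) (t (s f)) (s f) (t f) => p q r u v; ring.
Qed.
End DividedDifference.

(* Double Schubert polynomials Y_v(x, y) indexed by codes v in N^m, as
   polynomials in 'X_0, ..., 'X_(m-1).  The letters of the second alphabet are
   arbitrary elements y 0, y 1, ... of the coefficient ring, since divided
   differences only act on x. *)
Section Schubert.
Variables (m : nat) (R : idomainType) (y : nat -> R).
Implicit Types (i j k l : 'I_m) (v w : {ffun 'I_m -> nat}).

Definition is_part v := [forall i : 'I_m, forall j : 'I_m, (i <= j)%N ==> (v j <= v i)%N].

Definition dominant v : {mpoly R[m]} :=
  \prod_i \prod_(j < v i) ('X_i - (y j)%:MP).

Definition ascent v : pred ('I_m * 'I_m) :=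
  fun p => (p.1.+1 == p.2) && (v p.1 < v p.2)%N.

(* The index of the divided difference of Y_v at a descent (v_i, v_j), j = i+1,
   of v: these two entries become (v_j, v_i - 1). *)
Definition vlower i j v : {ffun 'I_m -> nat} :=
  [ffun k => if k == i then v j else if k == j then (v i).-1 else v k].

(* Inverse of vlower, defined when v_i <= v_j. *)
Definition vraise i j v : {ffun 'I_m -> nat} :=
  [ffun k => if k == i then (v j).+1 else if k == j then v i else v k].

(* Unless v is a partition it has an ascent (i, j), and Y_v is the divided
   difference of Y_(vraise i j v).  The fuel vdepth v suffices to reach a
   partition, and schubert_dominant together with ddiff_schubert show that the
   result does not depend on the ascents picked: schubert satisfies the defining
   recursion at every descent. *)
Fixpoint schubert_rec d v : {mpoly R[m]} :=
  if [pick p | ascent v p] is Some p then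
    if d is d'.+1 then ddiff p.1 p.2 (schubert_rec d' (vraise p.1 p.2 v)) else 0
  else dominant v.

Definition vdepth v := (m * \max_i (v i + i) - \sum_i v i)%N.

Definition schubert v := schubert_rec (vdepth v) v.

Lemma vraise_depth i j v : i.+1 = j :> nat -> (v i <= v j)%N ->
  (vdepth (vraise i j v) < vdepth v)%N.
Proof.
move=> def_j le_v; rewrite /vdepth.
have neq_ji : j != i by rewrite -val_eqE /= -def_j; lia.
have leB : (\max_k (vraise i j v k + k) <= \max_i (v i + i))%N.
  apply/bigmax_leqP => k _; rewrite ffunE.
  have /= Hj := leq_bigmax (F := fun i => (v i + i)%N) j.
  case: ifP => [/eqP->|_]; first by apply: leq_trans Hj; lia.
  case: ifP => [/eqP->|_]; first by apply: leq_trans Hj; lia.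
  exact: (leq_bigmax (F := fun i => (v i + i)%N) k).
have defS : (\sum_k (vraise i j v) k = (\sum_i v i).+1)%N.
  rewrite (bigD1 i) // (bigD1 j) //= [in RHS](bigD1 i) // [in RHS](bigD1 j) //=.
  rewrite (eq_bigr v) => [|k /andP[/negPf ki /negPf kj]]; last by rewrite ffunE ki kj.
  by rewrite !ffunE !eqxx (negPf neq_ji) addSn addnCA.
have leS w : (\sum_i w i <= m * \max_i (w i + i))%N.
  have -> : (m * \max_i (w i + i) = \sum_(k < m) \max_i (w i + i))%N.
    by rewrite sum_nat_const card_ord.
  apply: leq_sum => k _.
  by apply: leq_trans (leq_bigmax (F := fun i => (w i + i)%N) k); rewrite leq_addr.
have := leS (vraise i j v); rewrite defS.
have : (m * \max_k (vraise i j v k + k) <= m * \max_i (v i + i))%N by rewrite leq_mul2l leB orbT.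
lia.
Qed.

Lemma schubert_rec_stable d e v :
  (vdepth v <= d)%N -> (vdepth v <= e)%N -> schubert_rec d v = schubert_rec e v.
Proof.
have no_ascent w : vdepth w = 0%N -> forall p, ascent w p = false.
  move=> w0 [i j]; apply/negP => /andP[/= /eqP def_j /ltnW le_w].
  by have := vraise_depth def_j le_w; rewrite w0.
elim: d e v => [|d IHd] [|e] v le_vd le_ve; first reflexivity; rewrite /=;
  case: pickP => [[i j] asc|_]; try exact: (erefl (dominant v)).
- by exfalso; move: le_vd; rewrite leqn0 => /eqP/no_ascent/(_ (i, j)); rewrite asc.
- by exfalso; move: le_ve; rewrite leqn0 => /eqP/no_ascent/(_ (i, j)); rewrite asc.
case/andP: (asc) => /eqP def_j /ltnW le_v.
have lt_d := vraise_depth def_j le_v.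
congr (ddiff _ _ _); apply: IHd; rewrite -ltnS.
  exact: leq_trans lt_d le_vd.
exact: leq_trans lt_d le_ve.
Qed.

Lemma schubert_pick v :
  schubert v = if [pick p | ascent v p] is Some p
               then ddiff p.1 p.2 (schubert (vraise p.1 p.2 v)) else dominant v.
Proof.
have -> : schubert v = schubert_rec (vdepth v).+1 v by apply: schubert_rec_stable.
rewrite /=; case: pickP => [[i j] /andP[/= /eqP def_j /ltnW le_v]|_]; last exact: erefl.
congr (ddiff _ _ _); apply: schubert_rec_stable; last exact: leqnn.
exact: ltnW (vraise_depth def_j le_v).
Qed.

Lemma ascentPn v : reflect (forall p, ascent v p = false) (is_part v).
Proof.
apply: (iffP 'forall_forallP) => [v_part [i j]|asc0 i j].
  apply/negP => /andP[/= /eqP def_j]; apply/negP; rewrite -leqNgt.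
  by have := v_part i j; rewrite -def_j leqnSn.
apply/implyP => /subnKC; move: (j - i)%N => d.
elim: d j => [|d IHd] j def_j; first by rewrite (_ : j = i) //; apply: val_inj; rewrite /= -def_j addn0.
have lt_m : (i + d < m)%N by have := ltn_ord j; lia.
apply: leq_trans (IHd (Ordinal lt_m) (erefl _)).
have /negbT := asc0 (Ordinal lt_m, j); rewrite /ascent /=.
by rewrite -def_j addnS eqxx /= -leqNgt.
Qed.

Lemma schubert_dominant v : is_part v -> schubert v = dominant v.
Proof. by move=> /ascentPn asc0; rewrite schubert_pick; case: pickP => // p; rewrite asc0. Qed.

End Schubert.

(* A partition with at most n-1 parts is a function on 'I_n.-1; indices of parts
   start at 0, so that rho = (n-1, ..., 1) has i-th part n - 1 - i. *)
Definition rho n : {ffun 'I_n.-1 -> nat} := [ffun i : 'I_n.-1 => (n.-1 - i)%N].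

Definition subpart m (la ka : {ffun 'I_m -> nat}) := [forall i, (la i <= ka i)%N].

Definition even_part m (la : {ffun 'I_m -> nat}) := [forall i, ~~ odd (la i)].

(* The k-th part of the conjugate partition, for k >= 1. *)
Definition conj_part m (la : {ffun 'I_m -> nat}) (k : nat) : nat :=
  #|[set i | (k <= la i)%N]|.

(* The index (rho/lambda) in N^(2n-2).  Position p of the ordinal type is the
   (p+1)-st entry, so odd p is entry number 2k with k = (p+1)/2. *)
Definition rho_quot n (la : {ffun 'I_n.-1 -> nat}) : {ffun 'I_(2 * n.-1) -> nat} :=
  [ffun p : 'I_(2 * n.-1) =>
     if odd p then let k := p.+1./2 in (n - k - conj_part la k)%N else 0%N].

(* All parts of a partition contained in rho are < n: letting the parts range
   over 'I_n makes the set of candidates finite. *)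
Definition bounded_part n (la : {ffun 'I_n.-1 -> 'I_n}) : {ffun 'I_n.-1 -> nat} :=
  [ffun i => val (la i)].

(* The indeterminate t_k, for k < n. *)
Definition tvar n (k : nat) : {mpoly int[n]} :=
  if insub k is Some i then 'X_(i : 'I_n) else 0.

(* The alphabet {t_0, t_1, 0, t_2, 0, t_3, 0, ...}; as for rho_quot, p is the
   (p+1)-st letter. *)
Definition ybar n (p : 'I_(2 * n.-1)) : {mpoly int[n]} :=
  if (p : nat) == 0%N then tvar n 0 else if odd p then tvar n p.+1./2 else 0.

(* Main.v *)
Require Import Defs.
From HB Require Import structures.
From mathcomp Require Import all_boot all_order all_algebra all_fingroup.
From mathcomp Require Import mpoly.
From mathcomp Require boolp.
From mathcomp Require Import ring zify.

(** Both sides are the same sum of determinants.  Write [e (d, X)] for the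
    elementary symmetric polynomial of degree [d] in the alphabet [X], and let
    [l k = k + la (n - k)] be the exponents of the alternant of a partition [la]
    with at most [n] parts.

    For the constant term, Littlewood's identity expands the product of all
    [1 / (1 - x i * x j)], [i <= j], as the sum of the Schur functions of the even
    partitions; multiplied by the Vandermonde product it becomes the sum of their
    alternants [det (x i ^ l k)] ([even_littlewood]).  The remaining factors are
    polynomials in one variable each, with coefficients [e (d, t 0 ... t j)] for
    the variable [x j], so that the constant term is the sum over the even
    partitions of [det (e (2 * j - l k, t 0 ... t j))] ([constant_term_sum]).  A
    zero block kills all the partitions that are not contained in [rho].

    Littlewood's identity is proved by induction on the number of variables.  The
    alternating sum over permutations, grouped according to the image of the first
    index, reduces it to [lagrange_zero], an interpolation formula.

    On the other side, [rho_quot la] is the code of a 321-avoiding permutation, for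
    which the Schubert polynomial is a determinant [det (e (f j - l k, x 0 ... ))]
    where row [j] involves the first [f j] variables ([schubert_flag]).  These
    determinants are stable under divided differences: as the flags [f j] are
    distinct, [ddiff] only acts on one row, where it lowers [f j] by one
    ([ddiff_flag_det]).  The codes change in the same way, so that by induction the
    Schubert polynomial and the determinant have the same divided differences.
    With one variable more than they involve, this makes their difference a
    constant, and the constant is zero for degree reasons.  The argument needs the
    divided differences of a Schubert polynomial at every position, hence the
    independence of its definition from the chosen ascents ([schubert_raise]), and
    its invariance under appending a zero to the code ([schubert_drop_last]).

    Finally, with [f j = 2 * j] and the alphabet [t 0, t 1, 0, t 2, 0, ...], the
    first [f j] letters are [t 0, ..., t j] and zeros, and the two determinants
    coincide. *)

Set Implicit Arguments.
Unset Strict Implicit.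
Unset Printing Implicit Defensive.

Import GRing.Theory.
Local Open Scope ring_scope.

(** * Divided differences *)

Section DdiffTheory.
Variables (m : nat) (R : idomainType).
Implicit Types (i j : 'I_m) (f g : {mpoly R[m]}) (u : 'X_{1..m}).

Lemma xswap_ddiff0 i j f : ddiff i j f = 0 -> xswap i j f = f.
Proof. by move=> d0; have /eqP := ddiffP i j f; rewrite d0 mul0r eq_sym subr_eq0 => /eqP. Qed.

Lemma ddiff0_xswap i j f : i != j -> xswap i j f = f -> ddiff i j f = 0.
Proof. by move=> ij sf; apply: ddiff_uniq => //; rewrite sf mul0r subrr. Qed.

Lemma xswap_ddiff i j f : i != j -> xswap i j (ddiff i j f) = ddiff i j f.
Proof.
move=> ij; apply/esym/ddiff_uniq => //; apply: oppr_inj; rewrite -mulrN opprB.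
have {1}-> : 'X_j - 'X_i = xswap i j ('X_i - 'X_j) :> {mpoly R[m]}.
  by rewrite xswapB !xswapX tpermL tpermR.
by rewrite -xswapM ddiffP xswapB xswapK opprB.
Qed.

Lemma ddiff_ddiff i j f : i != j -> ddiff i j (ddiff i j f) = 0.
Proof. by move=> ij; apply: ddiff0_xswap => //; apply: xswap_ddiff. Qed.

Lemma ddiffB i j f g : i != j -> ddiff i j (f - g) = ddiff i j f - ddiff i j g.
Proof.
move=> ij; apply: ddiff_uniq => //.
move: (ddiffP i j f) (ddiffP i j g); move: (ddiff i j f) (ddiff i j g) => p q.
rewrite mulrBl xswapB => -> ->; move: (xswap i j f) (xswap i j g) => a b.
by rewrite !opprD !opprK addrACA.
Qed.

(** If [g * ('X_i - 'X_j) = f], comparing the coefficients of [u + U_(i)] shows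
    that a coefficient of [g] is the sum of a coefficient of [f] and of another
    coefficient of [g], with a smaller exponent of ['X_j]. *)
Lemma mcoeff_divX i j f g u : i != j -> g * ('X_i - 'X_j) = f ->
  (forall w : 'X_{1..m}, (w j <= u j)%N -> mdeg w = mdeg u ->
     (forall k, k != i -> k != j -> w k = u k) -> f@_(w + U_(i))%MM = 0) ->
  g@_u = 0.
Proof.
move=> ij def_f; have [d] := ubnP (u j); elim: d u => // d IHd u ltd f0.
have /(congr1 (mcoeff (u + U_(i))%MM)) := def_f.
rewrite f0 // mulrBr mcoeffB [(u + _)%MM]addmC mcoeffMX.
have [uj0|uj0] := posnP (u j).
  suff -> : (g * 'X_j)@_(U_(i) + u) = 0 by rewrite subr0.
  rewrite mcoeffMr big1 // => -[[a Ha] [b Hb]] /= /eqP def_u.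
  rewrite mcoeffX; case: eqP => [ej|_]; last by rewrite mulr0.
  have := congr1 (fun w : 'X_{1..m} => w j) def_u.
  by rewrite -ej !mnmDE !mnm1E eqxx (negPf ij) uj0; lia.
have le_j : (U_(j) <= u)%MM.
  by apply/mnm_lepP => k; rewrite mnm1E; case: eqP => // <-.
have -> : (U_(i) + u = U_(j) + (u - U_(j) + U_(i)))%MM.
  by rewrite addmA [(U_(j) + _)%MM]addmC submK // addmC.
rewrite mcoeffMX.
suff -> : g@_(u - U_(j) + U_(i))%MM = 0 by rewrite subr0.
have degw : mdeg (u - U_(j) + U_(i))%MM = mdeg u.
  by rewrite -[in RHS](submK le_j) !mdegD !mdeg1.
apply: IHd => [|w lew dw kw].
  by rewrite mnmDE mnmBE !mnm1E eqxx (negPf ij); lia.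
apply: f0 => //.
- by apply: leq_trans lew _; rewrite mnmDE mnmBE !mnm1E eqxx (negPf ij); lia.
- by rewrite dw.
- move=> k ki kj; rewrite kw // mnmDE mnmBE !mnm1E.
  by rewrite ![_ == k]eq_sym (negPf ki) (negPf kj) subn0 addn0.
Qed.

Definition vanish_below d f := forall u, (mdeg u < d)%N -> f@_u = 0.

(** Divided differences lower the order of vanishing at the origin by one. *)
Lemma ddiff_vanish d i j f : i != j ->
  vanish_below d.+1 f -> vanish_below d (ddiff i j f).
Proof.
move=> ij f0 u ltu; apply: (mcoeff_divX ij (ddiffP i j f)) => w _ dw _.
have lt_d : (mdeg (w + U_(i)) < d.+1)%N by rewrite mdegD mdeg1 dw addn1.
by rewrite mcoeffB mcoeff_sym !f0 ?mdeg_mperm ?subrr.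
Qed.

Definition free_of (k : 'I_m) f := forall u, (0 < u k)%N -> f@_u = 0.

Lemma ddiff_free k i j f : i != j -> k != i -> k != j ->
  free_of k f -> free_of k (ddiff i j f).
Proof.
move=> ij ki kj f0 u ltu; apply: (mcoeff_divX ij (ddiffP i j f)) => w _ _ eqw.
have lt_k : (0 < (w + U_(i)%MM)%MM k)%N by rewrite mnmDE eqw // ltn_addr.
rewrite mcoeffB mcoeff_sym !f0 ?subrr //.
by rewrite mnmE tpermD // eq_sym.
Qed.

(** A symmetric polynomial that misses one variable misses all of them. *)
Lemma sym_free_const f (k : 'I_m) : k.+1 = m ->
    (forall i j, i.+1 = j :> nat -> xswap i j f = f) -> free_of k f ->
  forall u, u != 0%MM -> f@_u = 0.
Proof.
move=> lastk symf freef u nz_u.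
have [i ui] : exists i, (0 < u i)%N.
  apply/existsP; apply: contraNT nz_u => /existsPn u0.
  by apply/eqP/mnmP => i; rewrite mnm0E; move: (u0 i); rewrite lt0n negbK => /eqP.
have [d] := ubnP (k - i)%N; elim: d u i ui {nz_u} => // d IHd u i ui ltd.
have [ik|neq_ik] := eqVneq i k; first by apply: freef; rewrite -ik.
have lti : (i.+1 < m)%N.
  by have := ltn_ord i; rewrite leq_eqVlt => /predU1P[e|//]; case/eqP: neq_ik; apply: val_inj; rewrite /= ; lia.
rewrite -(symf i (Ordinal lti) (erefl _)) mcoeff_sym.
apply: (IHd _ (Ordinal lti)); first by rewrite mnmE tpermR.
by rewrite /=; lia.
Qed.

End DdiffTheory.

Section FreeOf.
Variables (m : nat) (R : idomainType) (k : 'I_m).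
Implicit Types (f g : {mpoly R[m]}).

Lemma free_of0 : free_of k (0 : {mpoly R[m]}).
Proof. by move=> u _; rewrite mcoeff0. Qed.

Lemma free_of1 : free_of k (1 : {mpoly R[m]}).
Proof. by move=> u uk; rewrite mcoeff1; case: eqP uk => // ->; rewrite mnm0E. Qed.

Lemma free_ofD f g : free_of k f -> free_of k g -> free_of k (f + g).
Proof. by move=> f0 g0 u uk; rewrite mcoeffD f0 // g0 // addr0. Qed.

Lemma free_ofM f g : free_of k f -> free_of k g -> free_of k (f * g).
Proof.
move=> f0 g0 u uk; rewrite mcoeffM big1 // => -[[a Ha] [b Hb]] /= /eqP def_u.
have [a0|a0] := posnP (a k); last by rewrite f0 ?mul0r.
by rewrite g0 ?mulr0 //; move: uk; rewrite def_u mnmDE a0.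
Qed.

Lemma free_ofN f : free_of k f -> free_of k (- f).
Proof. by move=> f0 u uk; rewrite mcoeffN f0 // oppr0. Qed.

Lemma free_of_sum (I : Type) (r : seq I) (P : pred I) (F : I -> {mpoly R[m]}) :
  (forall q, P q -> free_of k (F q)) -> free_of k (\sum_(q <- r | P q) F q).
Proof. by move=> F0; apply: big_ind => //; [exact: free_of0 | exact: free_ofD]. Qed.

Lemma free_of_prod (I : Type) (r : seq I) (P : pred I) (F : I -> {mpoly R[m]}) :
  (forall q, P q -> free_of k (F q)) -> free_of k (\prod_(q <- r | P q) F q).
Proof. by move=> F0; apply: big_ind => //; [exact: free_of1 | exact: free_ofM]. Qed.

Lemma free_ofX (l : 'I_m) : l != k -> free_of k ('X_l : {mpoly R[m]}).
Proof.
by move=> lk u uk; rewrite mcoeffX; case: eqP uk => // <-; rewrite mnm1E (negPf lk).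
Qed.

Lemma free_of_det s (M : 'M[{mpoly R[m]}]_s) :
  (forall a b, free_of k (M a b)) -> free_of k (\det M).
Proof.
move=> M0; apply: free_of_sum => sg _; refine (free_ofM _ _); last by apply: free_of_prod.
by case: (sg : bool); [refine (free_ofN _) |]; exact: free_of1.
Qed.

End FreeOf.

(** * Schubert polynomials do not depend on the chosen ascents *)

Section SchubertTheory.
Variables (m : nat) (R : idomainType) (y : nat -> R).
Implicit Types (i j k l : 'I_m) (v w : {ffun 'I_m -> nat}).
Local Notation Y := (schubert y).

Lemma ord_succ_neq i j : i.+1 = j :> nat -> i != j.
Proof. by move=> e; apply/eqP => eij; rewrite eij in e; lia. Qed.

Lemma vraise_comm i j k l v : i != k -> i != l -> j != k -> j != l ->
  vraise i j (vraise k l v) = vraise k l (vraise i j v).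
Proof.
move=> ik il jk jl; apply/ffunP => p; rewrite !ffunE.
have neq := (eq_sym k i, eq_sym l i, eq_sym k j, eq_sym l j).
rewrite !neq (negPf ik) (negPf il) (negPf jk) (negPf jl).
case: (eqVneq p i) => [->|_]; first by rewrite (negPf ik) (negPf il).
case: (eqVneq p j) => [->|//]; first by rewrite (negPf jk) (negPf jl).
Qed.

Lemma vraise_braid i j k v : i != j -> j != k -> i != k ->
  vraise i j (vraise j k (vraise i j v)) = vraise j k (vraise i j (vraise j k v)).
Proof.
move=> ij jk ik; apply/ffunP => p; rewrite !ffunE !eqxx.
have neq := (eq_sym j i, eq_sym k j, eq_sym k i).
rewrite !neq (negPf ij) (negPf jk) (negPf ik) ?eqxx.
case: (eqVneq p i) => [->|_]; first by rewrite (negPf ij) (negPf ik).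
by case: (p == j); case: (p == k).
Qed.

Lemma vlowerK i j v : i != j -> (v j < v i)%N -> vraise i j (vlower i j v) = v.
Proof.
move=> ij lt_v; apply/ffunP => p; rewrite !ffunE !eqxx [j == i]eq_sym (negPf ij).
case: (eqVneq p i) => [->|_]; first exact: ltn_predK lt_v.
by case: eqP => [->|].
Qed.

Lemma xswap_dominant i j v : v i = v j -> xswap i j (dominant y v) = dominant y v.
Proof.
move=> eq_v; rewrite /xswap /dominant rmorph_prod (reindex_inj (@perm_inj _ (tperm i j))) /=.
apply: eq_bigr => k _; rewrite rmorph_prod /=.
have -> : v (tperm i j k) = v k by case: tpermP => [->|->|].
apply: eq_bigr => l _.
by rewrite -[msym _ _]/(xswap i j _) xswapB xswapX tpermK [xswap _ _ _%:MP]mmapC.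
Qed.

(** At the beginning of a block of equal parts of a partition, raising produces
    a partition again, so that both sides are products of linear factors. *)
Lemma dominant_raise i j v : i.+1 = j :> nat -> is_part v -> v i = v j ->
    (forall k, (k < i)%N -> (v i < v k)%N) ->
  dominant y v = ddiff i j (Y (vraise i j v)).
Proof.
move=> ij part_v eq_v lt_v; have neq_ij := ord_succ_neq ij.
have raiseE p : vraise i j v p = ((p == i) + v p)%N.
  rewrite ffunE; case: eqP => [->|_]; first by rewrite -eq_v.
  by case: eqP => [->|].
rewrite schubert_dominant; last first.
  apply/'forall_forallP => a b; apply/implyP => le_ab; rewrite !raiseE.
  have /forallP/(_ a)/forallP/(_ b)/implyP/(_ le_ab) vab := part_v.
  have [eb|_] := eqVneq b i; last by apply: leq_trans vab (leq_addl _ _).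
  rewrite eb in le_ab *; case: eqP => [->//|nai]; rewrite addnC addn1 add0n.
  by apply: lt_v; rewrite ltn_neqAle le_ab andbT; apply/eqP => e; case: nai; apply: val_inj.
have -> : dominant y (vraise i j v) = dominant y v * ('X_i - (y (v i))%:MP).
  rewrite /dominant (bigD1 i) //= [in RHS](bigD1 i) //= mulrAC; congr (_ * _); last first.
    by apply: eq_bigr => k /negPf ki; rewrite raiseE ki.
  by rewrite raiseE eqxx add1n big_ord_recr.
apply/esym/ddiff_uniq => //; rewrite xswapM xswap_dominant // xswapB xswapX tpermL.
by rewrite [xswap _ _ _%:MP]mmapC; ring.
Qed.

(** Commutation of distant divided differences and the braid relation make the
    choice of the raised pair irrelevant, provided that this is known for the
    codes of smaller depth.  These relations are the only properties of [ddiff]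
    that enter, whence the abstract operators [d]. *)
Lemma raise_indep (T : Type) (d : 'I_m -> 'I_m -> T -> T) (Z : {ffun 'I_m -> nat} -> T) v i j k l :
    (forall i j k l f, i != j -> k != l -> i != k -> i != l -> j != k -> j != l ->
       d k l (d i j f) = d i j (d k l f)) ->
    (forall i j k f, i != j -> j != k -> i != k ->
       d i j (d j k (d i j f)) = d j k (d i j (d j k f))) ->
    (forall w i j, (vdepth w < vdepth v)%N -> i.+1 = j :> nat -> (w i <= w j)%N ->
       Z w = d i j (Z (vraise i j w))) ->
    i.+1 = j :> nat -> k.+1 = l :> nat -> (v i <= v j)%N -> (v k <= v l)%N ->
  d i j (Z (vraise i j v)) = d k l (Z (vraise k l v)).
Proof.
move=> d_comm d_braid IH; wlog: i j k l / (i <= k)%N => [wlog_ik|].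
  case/orP: (leq_total i k) => [le_ik|le_ki] ij kl vij vkl.
    exact: (wlog_ik i j k l).
  by rewrite (wlog_ik k l i j).
rewrite leq_eqVlt => /predU1P[/val_inj-> |lt_ik].
  by move=> ->  /val_inj->.
move=> ij kl vij vkl.
have nij := ord_succ_neq ij; have nkl := ord_succ_neq kl.
have nik : i != k by rewrite -val_eqE /=; lia.
have nil : i != l by rewrite -val_eqE /=; lia.
have ltr := vraise_depth ij vij; have ltr' := vraise_depth kl vkl.
have [ejk|njk] := eqVneq j k; last first.
  have njl : j != l by rewrite -val_eqE /=; move: njk; rewrite -val_eqE /=; lia.
  have neq := (eq_sym k i, eq_sym l i, eq_sym k j, eq_sym l j).
  have v1 : (vraise i j v k <= vraise i j v l)%N.
    by rewrite !ffunE ?neq ?(negPf nik) ?(negPf njk) ?(negPf nil) ?(negPf njl).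
  have v2 : (vraise k l v i <= vraise k l v j)%N.
    by rewrite !ffunE ?(negPf nik) ?(negPf njk) ?(negPf nil) ?(negPf njl).
  rewrite (IH _ _ _ ltr kl v1) (IH _ _ _ ltr' ij v2).
  by rewrite (d_comm i j k l) // (vraise_comm _ nik).
(* three consecutive entries: raise the resulting codes twice more and braid *)
subst k; have neq := (eq_sym j i, eq_sym l j, eq_sym l i).
have simp := (ffunE, eqxx, neq, negPf nij, negPf nkl, negPf nil).
have v1 : (vraise i j v j <= vraise i j v l)%N by rewrite !simp; lia.
have v2 : (vraise j l v i <= vraise j l v j)%N by rewrite !simp; lia.
have lt1 := ltn_trans (vraise_depth kl v1) ltr.
have lt2 := ltn_trans (vraise_depth ij v2) ltr'.
have v3 : (vraise j l (vraise i j v) i <= vraise j l (vraise i j v) j)%N.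
  by rewrite !simp; lia.
have v4 : (vraise i j (vraise j l v) j <= vraise i j (vraise j l v) l)%N.
  by rewrite !simp; lia.
rewrite (IH _ _ _ ltr kl v1) (IH _ _ _ ltr' ij v2).
rewrite (IH _ _ _ lt1 ij v3) (IH _ _ _ lt2 kl v4).
by rewrite d_braid // vraise_braid.
Qed.

(** The equation holds for one raised pair: the chosen ascent or, for a partition,
    the beginning of a block of equal parts.  It then holds for all of them. *)
Lemma schubert_raise i j v : i.+1 = j :> nat -> (v i <= v j)%N ->
  Y v = ddiff i j (Y (vraise i j v)).
Proof.
have [d] := ubnP (vdepth v); elim: d v i j => // d IHd v i j ltd ij le_v.
have indep k l : k.+1 = l :> nat -> (v k <= v l)%N ->
    ddiff k l (Y (vraise k l v)) = ddiff i j (Y (vraise i j v)).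
  move=> kl le_kl; apply: raise_indep kl ij le_kl le_v.
  - exact: ddiffC.
  - exact: ddiff_braid.
  - by move=> w a b ltw; apply: IHd; apply: leq_trans ltw _.
rewrite schubert_pick; case: pickP => [[k l] /andP[/= /eqP kl /ltnW le_kl]|asc0].
  exact: indep.
have part_v : is_part v by apply/ascentPn.
have mono (a b : 'I_m) : (a <= b)%N -> (v b <= v a)%N.
  by have /forallP/(_ a)/forallP/(_ b)/implyP := part_v.
have eq_v : v i = v j by apply/eqP; rewrite eqn_leq le_v mono // -ij.
(* k starts the block of parts equal to v i *)
have [k /eqP vk min_k] := @arg_minnP _ i (fun k => v k == v i) val (eqxx _).
have le_ki : (k <= i)%N by apply: min_k.
have ltl : (k.+1 < m)%N by rewrite (leq_ltn_trans _ (ltn_ord j)) // -ij.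
pose l := Ordinal ltl.
have vl : v k = v l.
  by apply/eqP; rewrite eqn_leq [X in _ && X]mono //= ?andbT vk eq_v mono //= -ij.
have le_kl : (v k <= v l)%N by rewrite vl.
rewrite -(indep k l (erefl _) le_kl); apply: dominant_raise => // p ltp.
rewrite ltn_neqAle mono 1?ltnW // andbT; apply/eqP => vp.
by have := min_k p; rewrite -vp vk eqxx => /(_ isT); rewrite leqNgt ltp.
Qed.

Lemma ddiff_schubert_ascent i j v : i.+1 = j :> nat -> (v i <= v j)%N ->
  ddiff i j (Y v) = 0.
Proof. by move=> ij /(schubert_raise ij)->; apply/ddiff_ddiff/ord_succ_neq. Qed.

Lemma ddiff_schubert_descent i j v : i.+1 = j :> nat -> (v j < v i)%N ->
  ddiff i j (Y v) = Y (vlower i j v).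
Proof.
move=> ij lt_v; have nij := ord_succ_neq ij.
rewrite (@schubert_raise i j (vlower i j v) ij) ?vlowerK //.
by rewrite !ffunE !eqxx eq_sym (negPf nij); lia.
Qed.

Lemma schubert_free (k : 'I_m) v : k.+1 = m -> v k = 0%N -> free_of k (Y v).
Proof.
move=> lastk; have [d] := ubnP (vdepth v); elim: d v => // d IHd v ltd vk0.
rewrite schubert_pick; case: pickP => [[i j] /andP[/= /eqP ij lt_v]|_].
  have nkj : k != j by apply/eqP => kj; rewrite -kj vk0 in lt_v.
  have nki : k != i.
    by apply/eqP => ki; move: (ltn_ord j); rewrite -ij -ki lastk ltnn.
  apply: (@ddiff_free _ _ k i j) => //=; first exact: ord_succ_neq.
  apply: IHd.
    exact: leq_trans (vraise_depth ij (ltnW lt_v)) _.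
  by rewrite ffunE (negPf nki) (negPf nkj).
apply: free_of_prod => l _; apply: free_of_prod => p _ u uk.
have nlk : l != k by apply/eqP => lk; move: p; rewrite lk vk0 => -[].
rewrite mcoeffB mcoeffX mcoeffC; case: eqP uk => [<-|_].
  by rewrite mnm1E (negPf nlk).
by case: eqP => [->|_]; rewrite ?mnm0E // mulr0 subr0.
Qed.

End SchubertTheory.

(** * Stability under appending a zero *)

Section Stability.
Variables (m : nat) (R : idomainType) (y : nat -> R).
Local Notation Y := (schubert y).

Definition drop_last_letter : m.+1.-tuple {mpoly R[m]} :=
  [tuple if unlift ord_max i is Some k then 'X_k else 0 | i < m.+1].

Local Notation pi := (comp_mpoly drop_last_letter).
Local Notation up := (lift ord_max).

Lemma drop_last_X (k : 'I_m) : pi 'X_(up k) = 'X_k.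
Proof. by rewrite comp_mpolyXU -tnth_nth tnth_mktuple liftK. Qed.

Lemma drop_last_X0 : pi 'X_(@ord_max m) = 0.
Proof. by rewrite comp_mpolyXU -tnth_nth tnth_mktuple unlift_none. Qed.

Lemma tperm_lift_max (i j k : 'I_m) : tperm (up i) (up j) (up k) = up (tperm i j k).
Proof.
have [->|ki] := eqVneq k i; first by rewrite !tpermL.
have [->|kj] := eqVneq k j; first by rewrite !tpermR.
by rewrite !tpermD // ?(inj_eq lift_inj) eq_sym.
Qed.

Lemma drop_last_xswap (i j : 'I_m) f :
  pi (xswap (up i) (up j) f) = xswap i j (pi f).
Proof.
elim/mpolyind: f => [|c u f _ _ IHf].
  by rewrite /xswap !(msym0, comp_mpoly0).
rewrite /xswap !(msymD, comp_mpolyD) [pi (msym _ f)]IHf msymZ !comp_mpolyZ msymZ.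
congr (c *: _ + _).
rewrite (mpolyXE_id R u) !rmorph_prod /=; apply: eq_bigr => k _.
rewrite !rmorphXn /=; congr (_ ^+ _).
rewrite -/(xswap (up i) (up j) 'X_k) -/(xswap i j (pi 'X_k)) xswapX.
case: (unliftP ord_max k) => [k'|] ->.
  by rewrite tperm_lift_max !drop_last_X xswapX.
have neq_up a : up a != ord_max by rewrite eq_sym neq_lift.
by rewrite tpermD ?neq_up // drop_last_X0 /xswap msym0.
Qed.

Lemma drop_last_ddiff (i j : 'I_m) f : i != j ->
  pi (ddiff (up i) (up j) f) = ddiff i j (pi f).
Proof.
move=> ij; apply/esym/ddiff_uniq => //.
by rewrite -drop_last_xswap -rmorphB -ddiffP rmorphM rmorphB /= !drop_last_X.
Qed.

(** The ascents of a code ending in zero do not involve its last entry, so that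
    the recursions for both codes run in parallel. *)
Lemma schubert_drop_last (w : {ffun 'I_m.+1 -> nat}) (v : {ffun 'I_m -> nat}) :
  w ord_max = 0%N -> (forall k, w (up k) = v k) -> pi (Y w) = Y v.
Proof.
have [d] := ubnP (vdepth v); elim: d v w => // d IHd v w ltd w0 wv.
have upE k : up k = k :> nat by rewrite lift_max.
have [part_v|] := boolP (is_part v).
  rewrite !schubert_dominant //; last first.
    apply/'forall_forallP => a b; apply/implyP => le_ab.
    case: (unliftP ord_max b) le_ab => [b'|] -> le_ab; last by rewrite w0.
    case: (unliftP ord_max a) le_ab => [a'|] ->; rewrite !upE => le_ab.
      rewrite !wv; have /forallP/(_ a')/forallP/(_ b')/implyP := part_v; exact.
    by have := ltn_ord b'; move: le_ab => /=; lia.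
  rewrite /dominant rmorph_prod (bigD1_ord ord_max) //= w0 big_ord0 rmorph1 mul1r.
  apply: eq_bigr => k _; rewrite rmorph_prod wv /=; apply: eq_bigr => l _.
  by rewrite rmorphB /= comp_mpolyC drop_last_X.
move=> npart; have [i [j [ij lt_v]]] :
    exists i j : 'I_m, i.+1 = j :> nat /\ (v i < v j)%N.
  have [[i j] /andP[/eqP ij lt_v]|asc0] := pickP (ascent v); first by exists i, j.
  by case/ascentPn: npart.
have ij' : (up i).+1 = up j :> nat by rewrite !upE.
rewrite (@schubert_raise _ _ y i j v ij (ltnW lt_v)).
rewrite (@schubert_raise _ _ y _ _ w ij') ?wv 1?ltnW //.
rewrite (drop_last_ddiff _ (ord_succ_neq ij)); congr (ddiff i j _); apply: IHd.
- exact: leq_trans (vraise_depth ij (ltnW lt_v)) _.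
- by rewrite ffunE !(negPf (neq_lift _ _)).
- by move=> k; rewrite !ffunE !(inj_eq lift_inj) !wv.
Qed.

End Stability.

(** * Determinants of elementary symmetric polynomials in initial alphabets *)

Section FlagDet.
Variables (m : nat) (R : idomainType).
Local Notation P := {mpoly R[m]}.

Definition flag_gen (f : nat) : {poly P} := \prod_(i < m | (i < f)%N) (1 + 'X_i *: 'X).

(** The elementary symmetric polynomial of degree [f - l] in the first [f]
    variables. *)
Definition elem_diff (f l : nat) : P := if (l <= f)%N then (flag_gen f)`_(f - l) else 0.

Definition flag_det s (f l : 'I_s -> nat) : P :=
  \det (\matrix_(j, k) elem_diff (f j) (l k)).

Lemma flag_gen_recr (i : 'I_m) : flag_gen i.+1 = flag_gen i * (1 + 'X_i *: 'X).
Proof.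
rewrite /flag_gen (bigD1 i) //= mulrC; congr (_ * _); apply: eq_bigl => k.
by rewrite ltnS [RHS]ltn_neqAle -val_eqE andbC.
Qed.

Lemma map_flag_gen_sym (i j : 'I_m) f : (i < f)%N = (j < f)%N ->
  map_poly (xswap i j : P -> P) (flag_gen f) = flag_gen f.
Proof.
move=> eq_f; rewrite /xswap /flag_gen rmorph_prod (reindex_inj (@perm_inj _ (tperm i j))) /=.
apply: eq_big => [k|k _]; first by case: tpermP => [->|->|]; rewrite ?eq_f.
rewrite rmorphD rmorph1 /= map_polyZ /= map_polyX; congr (1 + _ *: _).
by rewrite -[msym _ _]/(xswap i j _) xswapX tpermK.
Qed.

Lemma xswap_elem_diff (i j : 'I_m) f l : (i < f)%N = (j < f)%N ->
  xswap i j (elem_diff f l) = elem_diff f l.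
Proof.
move=> eq_f; rewrite /elem_diff; case: ifP => _; last exact: msym0.
by rewrite -{2}(map_flag_gen_sym eq_f) coef_map.
Qed.

Lemma elem_diff_step (i j : 'I_m) l : i.+1 = j :> nat ->
  elem_diff i.+1 l - xswap i j (elem_diff i.+1 l) =
    ('X_i - 'X_j) * elem_diff i l.
Proof.
move=> ij; rewrite /elem_diff; case: (leqP l i.+1) => [le_l|lt_l]; last first.
  by rewrite leqNgt ltnW //= [xswap _ _ _]msym0 subr0 mulr0.
rewrite -[xswap i j _](coef_map (msym (tperm i j))) -coefB.
rewrite flag_gen_recr rmorphM /= [map_poly _ (flag_gen i)]map_flag_gen_sym; last first.
  by rewrite -ij ltnn ltnNge leqnSn.
rewrite rmorphD rmorph1 /= map_polyZ /= map_polyX -[msym _ _]/(xswap i j _) xswapX tpermL.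
rewrite -mulrBr opprD addrACA subrr add0r -scalerBl -scalerAr coefZ coefMX.
have [le_li|lt_il] := leqP l i; first by rewrite subSn.
by have -> : (i.+1 - l = 0)%N by lia.
Qed.

Definition upd s (f : 'I_s -> nat) (j0 : 'I_s) (a : nat) (j : 'I_s) : nat :=
  if j == j0 then a else f j.

(** Only one row changes when the flags are pairwise distinct, so a divided
    difference acts on the determinant by lowering one flag. *)
Lemma ddiff_flag_det s (f l : 'I_s -> nat) (i j : 'I_m) (j0 : 'I_s) :
    injective f -> i.+1 = j :> nat -> f j0 = i.+1 ->
  ddiff i j (flag_det f l) = flag_det (upd f j0 i) l.
Proof.
move=> injf ij fj0; apply: ddiff_uniq; first exact: ord_succ_neq.
have other k : k != j0 -> (i < f k)%N = (j < f k)%N.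
  by move=> kj0; rewrite -ij [RHS]ltn_neqAle -fj0 (inj_eq injf) eq_sym kj0.
rewrite /xswap /flag_det -det_map_mx mulrC.
set A := \matrix_(_, _) _; set B := \matrix_(_, _) _; set C := map_mx _ _.
suff -> : \det B = ('X_i - 'X_j) * \det A + 1 * \det C by rewrite mul1r addrK.
apply: (determinant_multilinear (i0 := j0)).
- apply/rowP => k; rewrite !mxE mul1r /upd eqxx fj0 -elem_diff_step //.
  by rewrite /= -/(xswap i j _) subrK.
- by apply/matrixP => a k; rewrite !mxE /upd eq_sym (negPf (neq_lift _ _)).
- apply/matrixP => a k; rewrite !mxE /= -/(xswap i j _) xswap_elem_diff //.
  by apply: other; rewrite eq_sym neq_lift.
Qed.

Lemma xswap_flag_det s (f l : 'I_s -> nat) (i j : 'I_m) :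
  i.+1 = j :> nat -> (forall k, f k != i.+1) -> xswap i j (flag_det f l) = flag_det f l.
Proof.
move=> ij fi; rewrite /xswap /flag_det -det_map_mx; congr (\det _).
apply/matrixP => a k; rewrite !mxE /= -/(xswap i j _) xswap_elem_diff //.
by rewrite -ij [RHS]ltn_neqAle eq_sym fi.
Qed.

Lemma flag_det_eq s (f l : 'I_s -> nat) a b : a != b -> f a = f b -> flag_det f l = 0.
Proof.
by move=> ab eq_f; apply: (determinant_alternate ab) => k; rewrite !mxE eq_f.
Qed.

End FlagDet.

Lemma card_lt_ord s a : (a <= s)%N -> #|[set k : 'I_s | (k < a)%N]| = a.
Proof.
move=> le_as; rewrite -sum1_card (eq_bigl (fun k : 'I_s => (k < a)%N)) => [|k]; last by rewrite inE.
by rewrite -(big_ord_widen _ (fun=> 1%N)) // sum1_card card_ord.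
Qed.

(** A matrix whose entries vanish in the rows up to [r] and the columns from [r]
    on is singular, as these are more than its size altogether. *)
Lemma det_zero_block (A : comNzRingType) s (M : 'M[A]_s) (r : 'I_s) :
  (forall j k : 'I_s, (j <= r)%N -> (r <= k)%N -> M j k = 0) -> \det M = 0.
Proof.
move=> M0; rewrite /(\det M) big1 // => sg _.
suff [j le_jr le_rj] : exists2 j : 'I_s, (j <= r)%N & (r <= sg j)%N.
  by rewrite (bigD1 j) //= M0 // mul0r mulr0.
apply/exists_inP; apply: contraT => /exists_inPn sg_lt.
have imS : sg @: [set j : 'I_s | (j <= r)%N] \subset [set k : 'I_s | (k < r)%N].
  apply/subsetP => _ /imsetP[j le_jr ->]; rewrite inE ltnNge.
  by apply: sg_lt; rewrite inE in le_jr.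
have := subset_leq_card imS; rewrite card_imset; last exact: perm_inj.
have -> : [set j : 'I_s | (j <= r)%N] = [set j : 'I_s | (j < r.+1)%N] by [].
by rewrite !card_lt_ord // ?ltnn // ltnW.
Qed.

(** * Schubert polynomials as determinants *)

Lemma free_of_elem_diff (m : nat) (R : idomainType) (k : 'I_m) (c d : nat) :
  (c <= k)%N -> free_of k (elem_diff m R c d).
Proof.
move=> le_fk; rewrite /elem_diff; case: ifP => _; last exact: free_of0.
move: (c - d)%N; rewrite /flag_gen; elim/big_ind: _ => [q|p q p0 q0 a|i lt_if q].
- by rewrite coef1; case: eqP => _; [exact: free_of1 | exact: free_of0].
- by rewrite coefM; apply: free_of_sum => b _; refine (free_ofM _ _).
rewrite coefD coef1 coefZ coefX; refine (free_ofD _ _).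
  by case: eqP => _; [exact: free_of1 | exact: free_of0].
refine (free_ofM _ _).
  by apply: free_ofX; apply/eqP => ik; rewrite ik ltnNge le_fk in lt_if.
by case: eqP => _; [exact: free_of1 | exact: free_of0].
Qed.

Section ConstantTerm.
Variables (m : nat) (R : idomainType).

Lemma vanish_dominant (v : {ffun 'I_m -> nat}) :
  vanish_below (\sum_i v i) (dominant (fun=> 0 : R) v).
Proof.
have -> : dominant (fun=> 0 : R) v = 'X_[[multinom v i | i < m]].
  rewrite mpolyXE_id; apply: eq_bigr => i _; rewrite mnmE.
  rewrite -[in RHS](card_ord (v i)) -prodr_const; apply: eq_bigr => j _.
  by rewrite mpolyC0 subr0.
move=> u ltu; rewrite mcoeffX; case: eqP ltu => // <-.
by rewrite mdegE; under eq_bigr do rewrite mnmE; rewrite ltnn.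
Qed.

Lemma sum_vraise (i j : 'I_m) (v : {ffun 'I_m -> nat}) : i != j ->
  (\sum_k vraise i j v k = (\sum_k v k).+1)%N.
Proof.
move=> ij; rewrite (bigD1 i) // (bigD1 j) 1?eq_sym //= [in RHS](bigD1 i) //.
rewrite [in RHS](bigD1 j) 1?eq_sym //=.
rewrite (eq_bigr v) => [|k /andP[/negPf ki /negPf kj]]; last by rewrite ffunE ki kj.
by rewrite !ffunE !eqxx [j == i]eq_sym (negPf ij) addSn addnCA.
Qed.

Lemma schubert_vanish (v : {ffun 'I_m -> nat}) :
  vanish_below (\sum_i v i) (schubert (fun=> 0 : R) v).
Proof.
have [d] := ubnP (vdepth v); elim: d v => // d IHd v ltd.
rewrite schubert_pick; case: pickP => [[i j] /andP[/= /eqP ij lt_v]|_]; last exact: vanish_dominant.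
apply: ddiff_vanish (ord_succ_neq ij) _; rewrite -(sum_vraise _ (ord_succ_neq ij)).
by apply: IHd; apply: leq_trans (vraise_depth ij (ltnW lt_v)) _.
Qed.

Lemma elem_diff_const f l : (elem_diff m R f l)@_0%MM = (f == l)%:R.
Proof.
rewrite /elem_diff; case: leqP => [le_lf|]; last by case: ltngtP; rewrite ?mcoeff0.
rewrite -[LHS](coef_map (mcoeff 0%MM : {mpoly R[m]} -> R)) /flag_gen rmorph_prod big1 /=.
  by rewrite coef1 subn_eq0 [in RHS]eqn_leq le_lf andbT.
move=> i _; rewrite rmorphD rmorph1 /= map_polyZ /= mcoeffX map_polyX.
case: eqP => [/(congr1 mdeg)|_]; first by rewrite mdeg1 mdeg0.
by rewrite scale0r addr0.
Qed.

End ConstantTerm.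

Section Code.
Variables (m s : nat).
Implicit Types (f l : 'I_s -> nat) (p i j : 'I_m) (a b : 'I_s).

Definition increasing f := forall a b, (a < b)%N -> (f a < f b)%N.

Lemma increasing_ltn f a b : increasing f -> (f a < f b)%N = (a < b)%N.
Proof.
move=> incf; apply/idP/idP => [|/incf//]; apply: contraTT; rewrite -!leqNgt.
by rewrite leq_eqVlt => /predU1P[/val_inj->//|/incf/ltnW].
Qed.

Lemma increasing_inj f : increasing f -> injective f.
Proof.
move=> incf a b eq_f; apply/val_inj/eqP; rewrite eqn_leq (leqNgt a) (leqNgt b).
by rewrite -!(increasing_ltn _ _ incf) eq_f ltnn.
Qed.

Lemma increasing_gap f a b : increasing f -> (a <= b)%N -> (f a + (b - a) <= f b)%N.
Proof.
move=> incf /subnKC; move: (b - a)%N => d; elim: d b => [|d IHd] b def_b.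
  by rewrite addn0 (_ : a = b) //; apply: val_inj; rewrite /= -def_b addn0.
have ltc : (a + d < s)%N by rewrite (leq_ltn_trans _ (ltn_ord b)) // -def_b addnS ltnW.
rewrite addnS; apply: leq_ltn_trans (IHd (Ordinal ltc) (erefl _)) _.
by apply: incf; rewrite /= -def_b addnS.
Qed.

Definition rank f p := #|[set a | (f a < p)%N]|.

(** The code of the 321-avoiding permutation that maps the positions [f] to the
    values [l] and is increasing on the other positions.  For a position [p]
    outside of [f], the inequality says that the value [l a] is smaller than the
    value at [p]: there are [l a - a] other values below [l a] and [p - rank f p]
    other positions before [p]. *)
Definition flag_code f l : {ffun 'I_m -> nat} :=
  [ffun p : 'I_m => if [exists a, f a == p] then 0%N
     else #|[set a | (p < f a)%N && (l a + rank f p <= p + a)%N]|].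

Lemma flag_code0 f l a p : f a = p -> flag_code f l p = 0%N.
Proof. by move=> fa; rewrite ffunE; case: existsP => // -[]; exists a; rewrite fa. Qed.

Lemma flag_codeE f l p : (forall a, f a != p) ->
  flag_code f l p = #|[set a | (p < f a)%N && (l a + rank f p <= p + a)%N]|.
Proof. by move=> nf; rewrite ffunE; case: existsP => // -[a]; rewrite (negPf (nf a)). Qed.

Lemma rankE f p a : increasing f -> f a = p -> rank f p = a.
Proof.
by move=> incf fa; rewrite -[RHS](card_lt_ord (ltnW (ltn_ord _))); apply: eq_card => b; rewrite !inE -fa increasing_ltn.
Qed.

Lemma rankS f i j : i.+1 = j :> nat -> (forall a, f a != i) -> rank f i = rank f j.
Proof.
by move=> ij nf; apply: eq_card => a; rewrite !inE -ij ltnS [RHS]leq_eqVlt (negPf (nf a)).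
Qed.

Section Step.
Variables (f l : 'I_s -> nat) (i j : 'I_m) (a0 : 'I_s).
Hypotheses (incf : increasing f) (ij : i.+1 = j :> nat) (fa0 : f a0 = j).
Hypothesis nfi : forall a, f a != i.

Let f' := upd f a0 i.

Let rank_i : rank f i = a0.
Proof. by rewrite (rankS ij nfi) (rankE incf fa0). Qed.

Let f'E a : a != a0 -> f' a = f a.
Proof. by rewrite /f' /upd => /negPf->. Qed.

Let f'a0 : f' a0 = i.
Proof. by rewrite /f' /upd eqxx. Qed.

Let nfj a : a != a0 -> f a != j.
Proof. by move=> na; rewrite -fa0 (inj_eq (increasing_inj incf)). Qed.

Lemma flag_code_flat : increasing l -> l a0 = j -> flag_code f l i = 0%N.
Proof.
move=> incl la0; rewrite flag_codeE //; apply: eq_card0 => a; rewrite inE rank_i.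
apply/negbTE/negP => /andP[lt_if le_l].
have le_a : (a0 <= a)%N by rewrite leqNgt -(increasing_ltn _ _ incf) fa0 -leqNgt -ij.
by have := increasing_gap incl le_a; rewrite la0; lia.
Qed.

Hypothesis la0 : (l a0 <= i)%N.

Lemma flag_code_step : flag_code f l i = (flag_code f' l j).+1.
Proof.
have nf'j a : f' a != j.
  have [->|na] := eqVneq a a0; first by rewrite f'a0 -ij neq_ltn ltnSn.
  by rewrite f'E // nfj.
have rank'_j : rank f' j = a0.+1.
  rewrite -rank_i /rank (cardsD1 a0) inE f'a0 -ij ltnSn add1n; congr _.+1.
  apply: eq_card => a; rewrite !inE; have [->|na] := eqVneq a a0; first by rewrite fa0 -ij; lia.
  by rewrite f'E //= ltnS leq_eqVlt (negPf (nfi a)).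
rewrite !flag_codeE // (cardsD1 a0) inE fa0 rank_i -ij ltnSn leq_add2r la0 add1n.
congr _.+1; apply: eq_card => a; rewrite !inE.
have [->|na] := eqVneq a a0; first by rewrite f'a0; lia.
have := nfj na; rewrite -ij in rank'_j *; rewrite f'E // rank'_j => nfa.
by rewrite /= addnS ltnS [in RHS]ltn_neqAle [in RHS]eq_sym nfa.
Qed.

Lemma flag_code_vlower : vlower i j (flag_code f l) = flag_code f' l.
Proof.
have nij := ord_succ_neq ij.
apply/ffunP => p; rewrite ffunE (flag_code0 _ fa0) flag_code_step /=.
have [->|pi] := eqVneq p i; first by rewrite (flag_code0 _ f'a0).
have [->//|pj] := eqVneq p j.
have neq : (p != i :> nat) && (p != j :> nat) by rewrite !val_eqE pi pj.
have lt_i : (p < i)%N = (p < j)%N by move: neq; rewrite -ij; lia.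
have gt_i : (i < p)%N = (j < p)%N by move: neq; rewrite -ij; lia.
have eq_rank : rank f' p = rank f p.
  apply: eq_card => a; rewrite !inE; have [->|na] := eqVneq a a0; last by rewrite f'E.
  by rewrite f'a0 fa0.
rewrite !ffunE; congr (if _ then _ else _).
  apply: eq_existsb => a; have [->|na] := eqVneq a a0; last by rewrite f'E.
  by move: neq; rewrite f'a0 fa0 ![_ == nat_of_ord p]eq_sym => /andP[/negPf-> /negPf->].
apply: eq_card => a; rewrite !inE eq_rank.
by have [->|na] := eqVneq a a0; [rewrite f'a0 fa0 lt_i | rewrite f'E].
Qed.

End Step.

Lemma flag_code_ascent f l i j : i.+1 = j :> nat -> (forall a, f a != j) ->
  (flag_code f l i <= flag_code f l j)%N.
Proof.
move=> ij nfj; have [/existsP[a /eqP fa]|/existsPn nfi] := boolP [exists a, f a == i].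
  by rewrite (flag_code0 _ fa).
rewrite !flag_codeE // -(rankS ij nfi); apply/subset_leq_card/subsetP => a.
rewrite !inE => /andP[lt_if le_l]; apply/andP; split.
  by rewrite ltn_neqAle -ij lt_if andbT eq_sym ij.
by apply: leq_trans le_l _; rewrite leq_add2r -ij.
Qed.

Lemma flag_code_id f p : increasing f -> flag_code f f p = 0%N.
Proof.
move=> incf; have [/existsP[a /eqP fa]|/existsPn nfp] := boolP [exists a, f a == p].
  by rewrite (flag_code0 _ fa).
rewrite flag_codeE //; apply: eq_card0 => a; rewrite inE.
apply/negbTE/negP => /andP[lt_pf le_f].
(* b is the first flag beyond p, so that it is preceded by rank f p flags *)
have [b lt_b min_b] := @arg_minnP _ a (fun a => (p < f a)%N) val lt_pf.
have le_ba : (b <= a)%N by apply: min_b.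
have rank_b : rank f p = b.
  rewrite -[RHS](card_lt_ord (ltnW (ltn_ord _))); apply: eq_card => c; rewrite !inE.
  rewrite ltn_neqAle nfp /= leqNgt; apply/idP/idP; last first.
    by apply: contraTN => /min_b; rewrite leqNgt.
  by move=> le_c; rewrite -(increasing_ltn _ _ incf) (leq_ltn_trans _ lt_b) // leqNgt.
have := increasing_gap incf le_ba; rewrite rank_b in le_f; lia.
Qed.

End Code.

(** Both sides have the same divided differences in the variables up to the last
    one, on which neither of them depends; hence they differ by a constant, which
    vanishes for degree reasons unless the code is zero. *)
Theorem schubert_flag (m s : nat) (R : idomainType) (last : 'I_m) (f l : 'I_s -> nat) :
    last.+1 = m -> increasing f -> increasing l ->
    (forall a, l a <= f a)%N -> (forall a, f a <= last)%N ->
  schubert (fun=> 0 : R) (flag_code m f l) = flag_det m R f l.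
Proof.
move=> lastm incf incl; have [d] := ubnP (\sum_a f a)%N.
elim: d f incf => // d IHd f incf ltd le_lf le_fk.
set Y := schubert _ _; set D := flag_det _ _ _ _.
have eq_dd (i j : 'I_m) : i.+1 = j :> nat -> ddiff i j Y = ddiff i j D.
  move=> ij; have nij := ord_succ_neq ij.
  have [/existsP[a0 /eqP fa0]|/existsPn nfj] := boolP [exists a, f a == j]; last first.
    rewrite (ddiff_schubert_ascent _ ij); last exact: flag_code_ascent.
    by rewrite [RHS]ddiff0_xswap // xswap_flag_det // => a; rewrite ij.
  rewrite /D (@ddiff_flag_det _ _ _ f l i j a0 (increasing_inj incf) ij) ?ij //.
  (* the lowered flag meets another one: two rows of the determinant are equal *)
  have [/existsP[a1 /eqP fa1]|/existsPn nfi] := boolP [exists a, f a == i].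
    have na : a1 != a0 by apply/eqP => e; move: fa0; rewrite -e fa1 -ij; lia.
    rewrite (@flag_det_eq _ _ _ _ _ a1 a0 na); last by rewrite /upd eqxx (negPf na).
    by rewrite (ddiff_schubert_ascent _ ij) // (flag_code0 _ fa1).
  have le_la : (l a0 <= j)%N by rewrite -fa0.
  move: le_la; rewrite leq_eqVlt => /predU1P[la0|]; last first.
    rewrite -ij ltnS => la0.
    have step := flag_code_step incf ij fa0 nfi la0.
    rewrite (ddiff_schubert_descent _ ij); last by rewrite step (flag_code0 _ fa0).
    rewrite (flag_code_vlower incf ij fa0 nfi la0); apply: IHd.
    - move=> a b ltab; rewrite /upd.
      have [ea|na] := eqVneq a a0; have [eb|nb] := eqVneq b a0.
      + by rewrite ea eb ltnn in ltab.
      + by apply: leq_ltn_trans (incf _ _ ltab); rewrite ea fa0 -ij.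
      + have := incf _ _ ltab; rewrite eb fa0 -ij ltnS leq_eqVlt.
        by rewrite (negPf (nfi a)).
      + exact: incf.
    - rewrite -ltnS; apply: leq_trans ltd; rewrite ltnS.
      rewrite (bigD1 a0) //= [X in (_ < X)%N](bigD1 a0) //= {1}/upd eqxx fa0 -ij ltnS.
      rewrite leq_add2l leq_eqVlt; apply/orP; left; apply/eqP; apply: eq_bigr => a na.
      by rewrite /upd (negPf na).
    - by move=> a; rewrite /upd; case: eqP => [->|].
    - by move=> a; rewrite /upd; case: eqP => // _; rewrite ltnW // ij -fa0.
  rewrite (ddiff_schubert_ascent _ ij); last first.
    by rewrite (flag_code_flat incf ij fa0 nfi incl la0).
  apply/esym/(det_zero_block (r := a0)) => a b le_a le_b; rewrite mxE /elem_diff leqNgt.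
  have ltl : (i < l b)%N by rewrite ij -la0; have := increasing_gap incl le_b; lia.
  suff le_i : (upd f a0 i a <= i)%N by rewrite (leq_ltn_trans le_i ltl).
  rewrite /upd; case: eqVneq => [//|na].
  by rewrite -ltnS ij -fa0 (increasing_ltn _ _ incf) ltn_neqAle na.
(* equal divided differences make the difference symmetric in all the variables *)
have const_diff u : u != 0%MM -> (Y - D)@_u = 0.
  apply: (sym_free_const lastm) => [i j ij|].
    have nij := ord_succ_neq ij.
    by apply: xswap_ddiff0; rewrite ddiffB // eq_dd // subrr.
  refine (free_ofD _ _); last first.
    by refine (free_ofN _); apply: free_of_det => a b; rewrite mxE; apply: free_of_elem_diff.
  apply: schubert_free lastm _; rewrite ffunE; case: ifP => // _; apply: eq_card0 => a.
  by rewrite inE ltnNge le_fk.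
suff YD0 : (Y - D)@_0%MM = 0.
  apply/eqP; rewrite -subr_eq0; apply/eqP/mpolyP => u; rewrite mcoeff0.
  by have [->|] := eqVneq u 0%MM; last exact: const_diff.
have [/forallP eq_fl|] := boolP [forall a, f a == l a].
  have code0 p : flag_code m f l p = 0%N.
    rewrite -(flag_code_id p incf) !ffunE; congr (if _ then _ else #|pred_of_set _|).
    by apply/setP => a; rewrite !inE (eqP (eq_fl a)).
  have -> : Y = 1.
    rewrite /Y schubert_dominant.
      by rewrite /dominant big1 // => p _; rewrite code0 big_ord0.
    by apply/'forall_forallP => p q; rewrite !code0 implybT.
  suff -> : D = 1 by rewrite subrr mcoeff0.
  rewrite /D /flag_det det_trig; last first.
    apply/is_trig_mxP => a b ltab; rewrite mxE /elem_diff -(eqP (eq_fl b)).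
    by rewrite leqNgt incf.
  apply: big1 => a _; rewrite mxE /elem_diff (eqP (eq_fl a)) leqnn subnn.
  rewrite /flag_gen coef0_prod big1 // => i _.
  by rewrite coefD coef1 coefZ coefX mulr0 addr0.
(* in the first row where f and l differ, l a0 is not a flag, so that the constant
   terms of column a0 vanish; and the position before f a0 is not a flag either,
   so that its code is positive *)
rewrite negb_forall => /existsP[a1 na1].
have [a0 na0 min_a0] := @arg_minnP _ a1 (fun a => f a != l a) val na1.
have lt_a0 : (l a0 < f a0)%N by rewrite ltn_neqAle eq_sym na0 le_lf.
have eq_lt (a : 'I_s) : (a < a0)%N -> f a = l a.
  by move=> lta; apply/eqP; apply: contraTT lta => /min_a0; rewrite -leqNgt.
have -> : (Y - D)@_0%MM = Y@_0%MM - D@_0%MM by rewrite mcoeffB.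
have -> : D@_0%MM = 0.
  rewrite /D /flag_det -[LHS]det_map_mx (expand_det_col _ a0) big1 // => a _.
  rewrite !mxE [X in X * _]elem_diff_const; case: eqP => [ea|]; last by rewrite mul0r.
  have [/eq_lt fa|le_a] := ltnP a a0.
    by by have e := increasing_inj incl (etrans (esym fa) ea); rewrite -e fa eqxx in na0.
  by have := increasing_gap incf le_a; rewrite ea; lia.
rewrite subr0; apply: schubert_vanish; rewrite mdeg0.
have p_lt : ((f a0).-1 < m)%N.
  by rewrite -lastm ltnS (leq_trans (leq_pred _)).
pose p := Ordinal p_lt.
have np a : f a != p.
  apply/eqP => fa; have fa' : (f a).+1 = f a0 by rewrite fa /=; lia.
  have lta : (a < a0)%N by rewrite -(increasing_ltn _ _ incf) -fa'.
  by have := incl _ _ lta; rewrite -(eq_lt _ lta); lia.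
rewrite (bigD1 p) //= addn_gt0; apply/orP; left.
rewrite flag_codeE // card_gt0; apply/set0Pn; exists a0; rewrite inE /=.
have -> : rank f p = a0.
  rewrite -[RHS](card_lt_ord (ltnW (ltn_ord _))); apply: eq_card => a; rewrite !inE -(increasing_ltn _ _ incf) /=.
  by have := np a; rewrite /=; lia.
by rewrite leq_add2r; lia.
Qed.

(** * Littlewood's identity for even partitions *)

Section Littlewood.
Variable A : comUnitRingType.

Definition vander n (x : 'I_n -> A) : A := \prod_(i < n) \prod_(j < n | (i < j)%N) (x j - x i).

Definition pair_prod n (x : 'I_n -> A) : A :=
  \prod_(i < n) \prod_(j < n | (i <= j)%N) (1 - x i * x j).

(** The alternating sum of the generating series of the sequences
    [l 0 < l 1 < ...] with [l k - k] even, that is, of the exponents of the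
    alternants of even partitions: the differences of consecutive exponents are
    chosen independently, each contributing a geometric series. *)
Definition even_alternant n (x : 'I_n -> A) : A :=
  \sum_(s : 'S_n) (-1) ^+ s *
    \prod_(k < n) (x (s k) ^+ k / (1 - \prod_(j < n | (k <= j)%N) x (s j) ^+ 2)).

Lemma vanderE n (x : 'I_n -> A) : vander x = \det (Vandermonde n (\row_i x i)).
Proof.
rewrite det_Vandermonde; apply: eq_bigr => i _; apply: eq_bigr => j _.
by rewrite !mxE.
Qed.

(** The first product has [\prod_(a <- r) - a] as its coefficient of the highest
    possible degree, and the second one is monic of that degree. *)
Lemma reciprocal_size (r : seq A) :
  let p : {poly A} := \prod_(a <- r) (1 - a *: 'X) in
  let q : {poly A} := \prod_(a <- r) ('X - a%:P) in
  (size (p - (\prod_(a <- r) - a) *: q)%R <= size r)%N.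
Proof.
pose p (s : seq A) : {poly A} := \prod_(a <- s) (1 - a *: 'X).
pose q (s : seq A) : {poly A} := \prod_(a <- s) ('X - a%:P).
have szp s : (size (p s) <= (size s).+1)%N.
  elim: s => [|a s IHs]; first by rewrite /p big_nil size_poly1.
  have -> : p (a :: s) = p s - a *: (p s * 'X).
    by rewrite /p big_cons mulrBl mul1r -scalerAl mulrC.
  rewrite (leq_trans (size_polyD _ _)) // size_polyN geq_max ltnW //=.
  by rewrite (leq_trans (size_scale_leq _ _)) // (leq_trans (size_polyMleq _ _)) // size_polyX addn2.
have szq s : (size (q s) <= (size s).+1)%N by rewrite /q size_prod_XsubC.
rewrite /= -/(p r) -/(q r); elim: r => [|a r IHr].
  by rewrite /p /q !big_nil scale1r subrr size_poly0.
have -> : p (a :: r) = p r - a *: (p r * 'X).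
  by rewrite /p big_cons mulrBl mul1r -scalerAl mulrC.
have -> : q (a :: r) = q r * 'X - a *: q r.
  by rewrite /q big_cons mulrBl mul_polyC mulrC.
rewrite big_cons; set c := \prod_(_ <- r) _ in IHr *.
have -> : p r - a *: (p r * 'X) - (- a * c) *: (q r * 'X - a *: q r) =
    p r - a *: ((p r - c *: q r) * 'X) - (a * c * a) *: q r.
  rewrite -!mul_polyC !polyCM polyCN.
  by move: (p r) (q r) 'X a%:P c%:P => P Q X a' c'; ring.
have szX (u : {poly A}) k : (size u <= k)%N -> (size (u * 'X)%R <= k.+1)%N.
  by move=> szu; rewrite (leq_trans (size_polyMleq _ _)) // size_polyX addn2.
rewrite (leq_trans (size_polyD _ _)) // size_polyN geq_max; apply/andP; split.
  rewrite (leq_trans (size_polyD _ _)) // size_polyN geq_max szp /=.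
  by rewrite (leq_trans (size_scale_leq _ _)) // szX.
by rewrite (leq_trans (size_scale_leq _ _)).
Qed.

(** By symmetry of [F], every pair involving [i] can be written with [i] first. *)
Lemma prod_remove n (F : 'I_n.+1 -> 'I_n.+1 -> A) (i : 'I_n.+1) :
  (forall a b, F a b = F b a) ->
  \prod_(a < n.+1) \prod_(b < n.+1 | (a <= b)%N) F a b =
    (\prod_b F i b) * \prod_(a < n) \prod_(b < n | (a <= b)%N) F (lift i a) (lift i b).
Proof.
move=> symF; rewrite (bigD1_ord i) //=.
have split_row (a : 'I_n) : \prod_(b < n.+1 | (lift i a <= b)%N) F (lift i a) b =
    (if (lift i a <= i)%N then F i (lift i a) else 1) *
    \prod_(b < n | (a <= b)%N) F (lift i a) (lift i b).
  rewrite big_mkcond (bigD1_ord i) //= symF; congr (_ * _).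
  by rewrite -big_mkcond; apply: eq_bigl => b; rewrite leq_bump2.
rewrite (eq_bigr _ (fun a _ => split_row a)) big_split mulrA; congr (_ * _).
rewrite (bigD1_ord i) //= -mulrA [RHS](bigD1_ord i) //=; congr (_ * _).
rewrite big_mkcond -big_split; apply: eq_bigr => a _ /=.
have := neq_bump i a; rewrite /=; case: ltngtP => // _ _; by rewrite ?mulr1 ?mul1r.
Qed.

(** The left-hand side is the expansion along the first row of the Vandermonde
    determinant whose first row is replaced by the values at the [x i] of
    [p = \prod_j (1 - z * x j)].  Modulo [q = \prod_j (z - x j)], which vanishes
    at these points, [p] has degree at most [n] and its constant coefficient
    becomes [1 - \prod_j x j ^ 2], which is the only one that matters, the other
    powers being among the remaining rows. *)
Lemma lagrange_zero n (x : 'I_n.+1 -> A) :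
  \sum_(i < n.+1) (-1) ^+ i * (\prod_(k < n) x (lift i k)) * vander (x \o lift i) *
      \prod_(j < n.+1) (1 - x i * x j)
    = (1 - \prod_j x j ^+ 2) * vander x.
Proof.
pose r := [seq x j | j : 'I_n.+1].
pose p := \prod_(a <- r) (1 - a *: 'X); pose q := \prod_(a <- r) ('X - a%:P).
pose c := \prod_(a <- r) - a; pose g := p - c *: q.
have szg : (size g <= n.+1)%N.
  by have := reciprocal_size r; rewrite size_map size_enum_ord.
pose B := \matrix_(a < n.+1, b < n.+1) (if a == ord0 then g`_b else (a == b)%:R).
pose V := Vandermonde n.+1 (\row_i x i).
have BV a j : (B *m V) a j = if a == ord0 then \prod_k (1 - x j * x k) else x j ^+ a.
  rewrite mxE; case: eqP => [->|/eqP na].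
    transitivity (g.[x j]).
      rewrite (horner_coef_wide _ szg); apply: eq_bigr => b _.
      by rewrite !mxE eqxx.
    rewrite /g hornerD hornerN hornerZ.
    have -> : q.[x j] = 0.
      rewrite /q /r big_image horner_prod (bigD1 j) //=.
      by rewrite hornerXsubC subrr mul0r.
    rewrite mulr0 subr0 /p /r big_image horner_prod; apply: eq_bigr => k _.
    by rewrite hornerD hornerC hornerN hornerZ hornerX mulrC.
  rewrite (bigD1 a) //= !mxE (negPf na) eqxx mul1r big1 ?addr0 // => b nb.
  by rewrite !mxE (negPf na) eq_sym (negPf nb) mul0r.
have <- : \det (B *m V) = (1 - \prod_j x j ^+ 2) * vander x.
  rewrite det_mulmx vanderE; congr (_ * _); rewrite -det_tr det_trig.
    rewrite (bigD1 ord0) //= big1 => [|a na]; last by rewrite !mxE (negPf na) eqxx.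
    rewrite !mxE eqxx mulr1 /g coefB coefZ.
    have -> : p`_0 = 1.
      by rewrite /p coef0_prod big1 // => a _; rewrite coefB coef1 coefZ coefX mulr0 subr0.
    have -> : q`_0 = c.
      by rewrite /q coef0_prod; apply: eq_bigr => a _; rewrite coefB coefX coefC sub0r.
    congr (_ - _); rewrite /c /r !big_image -big_split; apply: eq_bigr => j _ /=.
    by rewrite mulrNN expr2.
  apply/is_trig_mxP => a b ltab; rewrite !mxE.
  have nb : b != ord0 by apply/eqP => eb; rewrite eb in ltab.
  by rewrite (negPf nb); case: eqP => // eab; rewrite eab ltnn in ltab.
rewrite (expand_det_row _ ord0); apply: eq_bigr => i _.
rewrite BV eqxx mulrC; congr (_ * _); rewrite /cofactor add0n -mulrA; congr (_ * _).
set M := row' _ _.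
have -> : M = Vandermonde n (\row_k x (lift i k)) *m diag_mx (\row_k x (lift i k)).
  apply/matrixP => a k; rewrite mul_mx_diag !mxE.
  have -> : \sum_j B (lift ord0 a) j * V j (lift i k) = (B *m V) (lift ord0 a) (lift i k).
    by rewrite mxE.
  by rewrite BV eq_sym (negPf (neq_lift _ _)) lift0 exprSr.
by rewrite det_mulmx det_diag -vanderE mulrC; congr (_ * _); apply: eq_bigr => k _; rewrite !mxE.
Qed.

Lemma reindex_lift_perm n (i : 'I_n.+1) :
  {on [pred s : 'S_n.+1 | s ord0 == i], bijective (lift_perm ord0 i)}.
Proof.
pose g (s : 'S_n.+1) := (s * (lift_perm ord0 (s ord0) 1)^-1)%g.
have g0 s : g s ord0 = ord0.
  by rewrite /g permM; apply: (canLR (permK _)); rewrite lift_perm_id.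
pose h (s : 'S_n.+1) (k : 'I_n) := odflt k (unlift ord0 (g s (lift ord0 k))).
have hE s k : lift ord0 (h s k) = g s (lift ord0 k).
  rewrite /h; case: unliftP => [k' -> //|e].
  have /perm_inj/eqP := etrans e (esym (g0 s)).
  by rewrite eq_sym (negPf (neq_lift _ _)).
have inj_h s : injective (h s).
  by move=> k k' /(congr1 (lift ord0)); rewrite !hE => /perm_inj/lift_inj.
exists (fun s => perm (inj_h s)) => [s _|s].
  apply/permP => k; rewrite permE; apply: (@lift_inj _ ord0); rewrite hE /g lift_perm_id permM.
  by apply: (canLR (permK _)); rewrite !lift_perm_lift perm1.
rewrite inE => /eqP si; apply/permP => k; case: (unliftP ord0 k) => [k'|] ->.
  rewrite lift_perm_lift permE.
  have := congr1 (lift_perm ord0 i 1) (hE s k'); rewrite lift_perm_lift perm1 => ->.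
  by rewrite /g si permM permKV.
by rewrite lift_perm_id.
Qed.

Lemma even_alternant_recl n (x : 'I_n.+1 -> A) :
  even_alternant x = (1 - \prod_j x j ^+ 2)^-1 *
    \sum_(i < n.+1) (-1) ^+ i * (\prod_(k < n) x (lift i k)) * even_alternant (x \o lift i).
Proof.
rewrite /even_alternant (partition_big (fun s : 'S_n.+1 => s ord0) predT) //= big_distrr /=.
apply: eq_bigr => i _; rewrite (reindex _ (reindex_lift_perm i)) /=.
rewrite (eq_bigl predT) => [|s]; last by rewrite lift_perm_id eqxx.
rewrite mulrA big_distrr /=; apply: eq_bigr => s _.
rewrite big_ord_recl lift_perm_id expr0 mul1r.
have -> : \prod_(j < n.+1 | (@ord0 n <= j)%N) x (lift_perm ord0 i s j) ^+ 2 = \prod_j x j ^+ 2.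
  by rewrite [RHS](reindex_inj (@perm_inj _ (lift_perm ord0 i s))).
have -> : (-1) ^+ lift_perm ord0 i s = (-1) ^+ i * (-1) ^+ s :> A.
  by rewrite odd_lift_perm /= signr_addb signr_odd.
set u := (1 - _)^-1.
have -> : \prod_k x (lift i k) = \prod_k x (lift i (s k)).
  by rewrite [LHS](reindex_inj (@perm_inj _ s)).
have -> : \prod_(k < n) (x (lift_perm ord0 i s (lift ord0 k)) ^+ lift ord0 k /
     (1 - \prod_(j < n.+1 | (lift ord0 k <= j)%N) x (lift_perm ord0 i s j) ^+ 2)) =
   (\prod_k x (lift i (s k))) * \prod_(k < n) ((x \o lift i) (s k) ^+ k /
     (1 - \prod_(j < n | (k <= j)%N) (x \o lift i) (s j) ^+ 2)).
  rewrite -big_split; apply: eq_bigr => k _ /=; rewrite lift_perm_lift exprS -mulrA.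
  congr (_ * (_ / (1 - _))); rewrite big_mkcond big_ord_recl /= mul1r -big_mkcond.
  by apply: eq_big => // j; rewrite lift_perm_lift.
by move: u (\prod_k x _) (\prod_k (_ / _)) ((-1) ^+ i) ((-1) ^+ s) => u a b e e'; ring.
Qed.

(** Induction on the number of variables; the inductive step amounts to evaluating
    at zero the Lagrange interpolation of the product of all [1 - z * x j]. *)
Theorem even_littlewood n (x : 'I_n -> A) :
    (forall r : seq 'I_n, r != [::] -> 1 - \prod_(j <- r) x j ^+ 2 \is a GRing.unit) ->
  even_alternant x * pair_prod x = vander x.
Proof.
elim: n x => [|n IHn] x Ux.
  rewrite /pair_prod /vander !big_ord0 mulr1 /even_alternant (big_pred1 1%g).
    by rewrite odd_perm1 big_ord0 mulr1.
  by move=> s; apply/esym/eqP/permP => -[].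
have Ue : 1 - \prod_j x j ^+ 2 \is a GRing.unit.
  by apply: Ux; rewrite -size_eq0 /index_enum -enumT size_enum_ord.
apply: (mulrI Ue); rewrite -lagrange_zero even_alternant_recl !mulrA divrr // mul1r.
rewrite big_distrl /=; apply: eq_bigr => i _.
rewrite /pair_prod (@prod_remove _ (fun a b => 1 - x a * x b) i); last first.
  by move=> a b; rewrite mulrC.
rewrite -(IHn (x \o lift i)) => [|r nr]; last first.
  by rewrite -(big_map (lift i) xpredT (fun j => x j ^+ 2)); apply: Ux; case: r nr.
by rewrite /pair_prod /= -!mulrA; do 3!congr (_ * _); rewrite mulrC.
Qed.

End Littlewood.

(** * Coefficients of power series *)

Section FpsCoef.
Variables (n : nat) (R : comNzRingType).
Implicit Types (u w m : 'X_{1..n}) (a b : R) (F : fps n R).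

Definition fmon a u : fps n R := Fps (fun m => if m == u then a else 0).

Lemma fcoef_fmonM a u F m :
  fcoef (fmon a u * F) m = if (u <= m)%MM then a * fcoef F (m - u)%MM else 0.
Proof.
rewrite fcoefM; case: ifP => [le_um|nle_um]; last first.
  rewrite big1 // => -[[k Hk] [l Hl]] /= /eqP def_m.
  case: eqP => [ku|_]; last by rewrite mul0r.
  by rewrite def_m ku lem_addr in nle_um.
have Hu : (mdeg u < (mdeg m).+1)%N by rewrite ltnS -(submK le_um) mdegD leq_addl.
have Hw : (mdeg (m - u)%MM < (mdeg m).+1)%N by rewrite ltnS -[in leqRHS](submK le_um) mdegD leq_addr.
rewrite (bigD1 (BMultinom Hu, BMultinom Hw)) /=; last by rewrite addmC submK.
rewrite eqxx big1 ?addr0 // => -[[k Hk] [l Hl]] /= /andP[/eqP def_m neq].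
case: eqP => [ku|_]; last by rewrite mul0r.
case/eqP: neq; congr (_, _); apply: val_inj => //=.
by rewrite def_m ku addmC addmK.
Qed.

Lemma fmonM a b u w : fmon a u * fmon b w = fmon (a * b) (u + w)%MM.
Proof.
apply: fps_eq => m; rewrite fcoef_fmonM /=; case: ifP => [le_um|nle_um].
  rewrite -[in RHS](submK le_um) [(_ + u)%MM]addmC eqm_add2l.
  by case: eqP; rewrite ?mulr0.
by case: eqP => // def_m; rewrite def_m lem_addr in nle_um.
Qed.

Lemma fmon_const a : fps_const n a = fmon a 0%MM. Proof. by []. Qed.

Lemma fmon_var i : fps_var R i = fmon 1 U_(i)%MM.
Proof. by apply: fps_eq => m /=; case: eqP. Qed.

Lemma fmon1 : fmon 1 0%MM = 1.
Proof. by apply: fps_eq => m; rewrite fcoef1 /=; case: eqP. Qed.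

Lemma fmonX u k : fmon 1 u ^+ k = fmon 1 (u *+ k)%MM.
Proof.
by elim: k => [|k IHk]; rewrite ?expr0 ?mulm0n ?fmon1 // exprS IHk fmonM mulr1 mulmS.
Qed.

Lemma fmon_prod (I : Type) (r : seq I) (P : pred I) (a : I -> R) (u : I -> 'X_{1..n}) :
  \prod_(i <- r | P i) fmon (a i) (u i) =
    fmon (\prod_(i <- r | P i) a i) (\sum_(i <- r | P i) u i)%MM.
Proof.
by elim/big_rec3: _ => [|i f c w _ ->]; [exact/esym/fmon1 | rewrite fmonM].
Qed.

Lemma fcoef_signM (s : bool) F m : fcoef ((-1) ^+ s * F) m = (-1) ^+ s * fcoef F m.
Proof. by case: s; rewrite ?mul1r // !mulN1r. Qed.

(** The monomials chosen in the univariate polynomials and the one chosen in [F]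
    have complementary exponents; the sum is indexed by the latter. *)
Lemma fcoef_prod_horner (B : nat) (p : 'I_n -> {poly R}) (d : 'I_n -> nat) F :
    (forall j, size (p j) <= B)%N -> (forall j, d j < B)%N ->
  fcoef ((\prod_j (map_poly (@fps_const n R) (p j)).[fps_var R j]) * F) [multinom d j | j < n] =
    \sum_(m : {ffun 'I_n -> 'I_B})
      (\prod_j (if (m j <= d j)%N then (p j)`_(d j - m j) else 0)) *
      fcoef F [multinom val (m j) | j < n].
Proof.
move=> szp ltd.
have hornerE j : (map_poly (@fps_const n R) (p j)).[fps_var R j] =
    \sum_(k < B) fmon ((p j)`_k) (U_(j) *+ k)%MM.
  rewrite (horner_coef_wide _ (leq_trans (size_poly _ _) (szp j))).
  apply: eq_bigr => k _; rewrite coef_map_id0; last by apply: fps_eq => u /=; case: eqP.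
  by rewrite fmon_var fmonX fmon_const fmonM mulr1 add0m.
rewrite (eq_bigr _ (fun j _ => hornerE j)) bigA_distr_bigA big_distrl fcoef_sum.
(* complement with respect to d, extended so as to be an involution *)
pose c (m : {ffun 'I_n -> 'I_B}) : {ffun 'I_n -> 'I_B} :=
  [ffun j => if (m j <= d j)%N then Ordinal (leq_ltn_trans (leq_subr (m j) _) (ltd j)) else m j].
have cE (m : {ffun 'I_n -> 'I_B}) j : c m j = (if (m j <= d j)%N then (d j - m j)%N else m j) :> nat.
  by rewrite ffunE; case: ifP.
have cK : involutive c.
  move=> m; apply/ffunP => j; apply: val_inj; rewrite /= !cE.
  by case: (leqP (m j) (d j)) => [le|lt]; rewrite ?leq_subr ?subKn // leqNgt lt.
rewrite (reindex_inj (inv_inj cK)); apply: eq_bigr => m _.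
rewrite fmon_prod fcoef_fmonM.
have sumE (f : 'I_n -> nat) : (\sum_j U_(j) *+ f j)%MM = [multinom f j | j < n].
  apply/mnmP => i; rewrite mnm_sumE (bigD1 i) //= big1 => [|j ji].
    by rewrite mulmnE mnm1E eqxx mul1n addn0 mnmE.
  by rewrite mulmnE mnm1E (negPf ji).
rewrite (sumE (fun j => c m j)).
have [/forallP le_m|] := boolP [forall j, (m j <= d j)%N].
  rewrite ifT; last by apply/mnm_lepP => j; rewrite !mnmE cE le_m leq_subr.
  congr (_ * fcoef F _); first by apply: eq_bigr => j _; rewrite cE le_m.
  by apply/mnmP => j; rewrite mnmBE !mnmE cE le_m subKn.
rewrite negb_forall => /existsP[j nle].
rewrite [in RHS](bigD1 j) //= (negPf nle) !mul0r.
case: ifP => // /mnm_lepP/(_ j); rewrite !mnmE cE (negPf nle).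
by rewrite (negPf nle).
Qed.

End FpsCoef.

(** * Exponent sequences of even partitions *)

Section EvenChain.
Variables (n : nat).
Implicit Types (l : 'I_n -> nat) (r : nat).

(** The [l k - k], in this order, are the parts of an even partition in weakly
    increasing order, the first [r] of which vanish. *)
Definition even_chain r l : bool :=
  [forall k : 'I_n, [&& (k <= l k)%N, ~~ odd (l k - k) & ((k < r)%N ==> (l k == k))]] &&
  [forall a : 'I_n, forall b : 'I_n, (a <= b)%N ==> (l a - a <= l b - b)%N].

Lemma even_chainP r l :
  reflect ((forall k : 'I_n, [/\ (k <= l k)%N, ~~ odd (l k - k) & ((k < r)%N -> l k = k)]) /\
           (forall a b : 'I_n, (a <= b)%N -> (l a - a <= l b - b)%N))
          (even_chain r l).
Proof.
apply: (iffP andP) => -[Hl mono]; split.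
- move=> k; have /and3P[-> -> /implyP lk] := forallP Hl k.
  by split=> // /lk/eqP.
- by move=> a b; apply/implyP; move: a b; apply/'forall_forallP.
- apply/forallP => k; have [-> -> lk] := Hl k; apply/implyP => /lk->; exact: eqxx.
- by apply/'forall_forallP => a b; apply/implyP; exact: mono.
Qed.

Definition lower_from r l (k : 'I_n) : nat := if (r <= k)%N then (l k - 2)%N else l k.

Lemma even_chainS r l (k : 'I_n) : r = k :> nat ->
  even_chain r.+1 l = even_chain r l && (l k == k).
Proof.
move=> ->; apply/even_chainP/andP => [[Hl mono]|[/even_chainP[Hl mono] /eqP lk]].
  split; last by have [_ _ ->] := Hl k.
  by apply/even_chainP; split=> // a; have [? ? la] := Hl a; split=> // ?; apply: la; lia.
split=> // a; have [? ? la] := Hl a; split=> //; rewrite ltnS leq_eqVlt.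
by case/predU1P => [/val_inj->|].
Qed.

(** If the part number [r] is not zero, then it is at least two, and so are all
    the later parts. *)
Lemma even_chain_lower (r : 'I_n) l :
  [forall k : 'I_n, (r <= k)%N ==> (2 <= l k)%N] && even_chain r (lower_from r l) =
    even_chain r l && (l r != r).
Proof.
apply/andP/andP => [[/forallP ge2 /even_chainP[Hl mono]]|[/even_chainP[Hl mono] nlr]].
  have ge2' (k : 'I_n) : (r <= k)%N -> (2 <= l k)%N by move=> ?; apply: (implyP (ge2 k)).
  have lr : (r + 2 <= l r)%N.
    by have [] := Hl r; have := ge2' r (leqnn r); rewrite /lower_from leqnn; lia.
  split; last by apply/eqP; lia.
  apply/even_chainP; split=> [k|a b le_ab].
    have [] := Hl k; rewrite /lower_from; case: ifP => [le_rk|_]; last by [].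
    have ge2k := ge2' k le_rk.
    move=> le_k ev_k _; split; [lia | | lia].
    have -> : (l k - k = (l k - 2 - k) + 2)%N by lia.
    by rewrite oddD (negPf ev_k).
  have := mono a b le_ab; have [] := Hl a; have [] := Hl b; rewrite /lower_from.
  case: (leqP r a) => ra; case: (leqP r b) => rb; [|lia| |lia].
    by have := ge2' a ra; have := ge2' b rb; lia.
  by have := ge2' b rb; lia.
have lr : (r + 2 <= l r)%N.
  have [le_r ev_r _] := Hl r; move/eqP: nlr => nlr.
  have : (l r - r != 1)%N by apply: contraNneq ev_r => ->.
  by move/eqP; lia.
have lk (k : 'I_n) : (r <= k)%N -> (k + 2 <= l k)%N.
  by move=> le_rk; have := mono r k le_rk; have [] := Hl k; lia.
split.
  by apply/forallP => k; apply/implyP => /lk; lia.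
apply/even_chainP; split=> [k|a b le_ab].
  have [] := Hl k; rewrite /lower_from; case: ifP => [le_rk|_]; last by [].
  have ge2k := lk k le_rk.
  move=> le_k ev_k _; split; [lia | | lia].
  have e : (l k - k = (l k - 2 - k) + 2)%N by lia.
  by rewrite e oddD addbF in ev_k.
have := mono a b le_ab; have [_ _ la] := Hl a; rewrite /lower_from.
case: (leqP r a) => ra; case: (leqP r b) => rb.
- by have := lk a ra; have := lk b rb; lia.
- lia.
- by rewrite (la ra) subnn.
- lia.
Qed.

Lemma even_chain_all l : even_chain n l = [forall k, l k == k].
Proof.
apply/even_chainP/forallP => [[Hl _] k|eq_l]; first by have [_ _ ->] := Hl k.
have lE k : l k = k by apply/eqP.
by split=> [k|a b _]; rewrite ?lE ?subnn.
Qed.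

End EvenChain.

Section EvenAlternantCoef.
Variables (n : nat) (R : comUnitRingType).
Implicit Types (r : nat) (s : 'S_n).
Local Notation x := (fps_var R : 'I_n -> fps n R).

Definition chain_series r (s : 'S_n) : fps n R :=
  Fps (fun m => (even_chain r (fun k => m (s k)))%:R).

Definition tail_mnm r (s : 'S_n) : 'X_{1..n} := (\sum_(j < n | (r <= j)%N) U_(s j) *+ 2)%MM.

Lemma tail_mnmE r s (k : 'I_n) : tail_mnm r s (s k) = if (r <= k)%N then 2%N else 0%N.
Proof.
rewrite /tail_mnm mnm_sumE big_mkcond (bigD1 k) //= big1 => [|j jk].
  by rewrite addn0 mulmnE mnm1E eqxx.
by rewrite mulmnE mnm1E (inj_eq perm_inj) (negPf jk) if_same.
Qed.

Lemma prod_tail r s : \prod_(j < n | (r <= j)%N) x (s j) ^+ 2 = fmon 1 (tail_mnm r s).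
Proof.
under eq_bigr do rewrite fmon_var fmonX.
by rewrite fmon_prod big1_eq.
Qed.

(** Multiplying by [1 - u ^ 2], where [u] is the product of the variables from
    index [r] on, cancels the sequences whose part number [r] is not zero: they
    are those obtained by adding two to all the parts from [r] on. *)
Lemma chain_series_step (r : 'I_n) s :
  chain_series r s * (1 - fmon 1 (tail_mnm r s)) = chain_series r.+1 s.
Proof.
apply: fps_eq => m; rewrite mulrBr mulr1 mulrC fcoefD fcoefN fcoef_fmonM mul1r /=.
set l := fun k => m (s k).
have -> : (tail_mnm r s <= m)%MM = [forall k : 'I_n, (r <= k)%N ==> (2 <= l k)%N].
  apply/mnm_lepP/forallP => [le_m k|ge2 i].
    by apply/implyP => le_rk; have := le_m (s k); rewrite tail_mnmE le_rk.
  rewrite -(permKV s i) tail_mnmE; have := implyP (ge2 (s^-1 i)%g).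
  by case: ifP => // _ /(_ isT).
have -> : even_chain r (fun k => (m - tail_mnm r s)%MM (s k)) = even_chain r (lower_from r l).
  congr even_chain; apply: boolp.funext => k; rewrite mnmBE tail_mnmE /lower_from.
  by case: ifP; rewrite ?subn0.
have -> (b c : bool) : (if b then c%:R else 0) = (b && c)%:R :> R by case: b.
rewrite even_chain_lower (@even_chainS n r l r) //.
by case: (even_chain r l); case: (l r == r); rewrite ?subr0 ?subrr.
Qed.

Lemma chain_series_prod r s : (r <= n)%N ->
  chain_series 0 s * \prod_(k < n | (k < r)%N) (1 - fmon 1 (tail_mnm k s)) = chain_series r s.
Proof.
elim: r => [_|r IHr lt_r]; first by rewrite big_pred0 ?mulr1.
rewrite (bigD1 (Ordinal lt_r)) //= mulrCA.
rewrite (eq_bigl (fun k : 'I_n => (k < r)%N)) => [|k]; last first.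
  by rewrite -val_eqE /= ltnS [RHS]ltn_neqAle andbC.
by rewrite IHr 1?ltnW // mulrC -(chain_series_step (Ordinal lt_r)).
Qed.

Lemma unit_sub1 (F : fps n R) : fcoef F 0%MM = 0 -> 1 - F \is a GRing.unit.
Proof. by move=> F0; rewrite fps_unitrE fcoefD fcoefN F0 fcoef1 eqxx subr0 unitr1. Qed.

Lemma fcoef0_varM i (F : fps n R) : fcoef (x i ^+ 2 * F) 0%MM = 0.
Proof.
rewrite fcoefM0 expr2 fcoefM0 fmon_var /=.
by case: eqP => [/(congr1 mdeg)|_]; rewrite ?mdeg0 ?mdeg1 // !mul0r.
Qed.

Lemma chain_seriesE s :
  chain_series 0 s =
    \prod_(k < n) (x (s k) ^+ k / (1 - \prod_(j < n | (k <= j)%N) x (s j) ^+ 2)).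
Proof.
have U (k : 'I_n) : 1 - fmon 1 (tail_mnm k s) \is a @GRing.unit (fps n R).
  by rewrite -prod_tail (bigD1 k) //=; apply/unit_sub1/fcoef0_varM.
rewrite big_split /= prodrV => [|k _]; last by rewrite prod_tail.
under [X in _ / X]eq_bigr do rewrite prod_tail.
apply: (canRL (mulrK _)); first by apply: rpred_prod => k _.
have -> : \prod_(k < n) (1 - fmon 1 (tail_mnm k s)) =
    \prod_(k < n | (k < n)%N) (1 - fmon 1 (tail_mnm k s)) :> fps n R.
  by apply: eq_bigl => k; rewrite ltn_ord.
rewrite chain_series_prod //; apply: fps_eq => m.
under eq_bigr do rewrite fmon_var fmonX.
rewrite fmon_prod big1_eq /= even_chain_all.
suff -> : [forall k : 'I_n, m (s k) == k] = (m == (\sum_k U_(s k) *+ k)%MM) by case: eqP.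
have sumE k : (\sum_k U_(s k) *+ k)%MM (s k) = k.
  rewrite mnm_sumE (bigD1 k) //= big1 => [|j jk].
    by rewrite addn0 mulmnE mnm1E eqxx mul1n.
  by rewrite mulmnE mnm1E (inj_eq perm_inj) (negPf jk).
apply/forallP/eqP => [mE|-> k]; last by rewrite sumE.
by apply/mnmP => i; rewrite -(permKV s i) sumE; apply/eqP.
Qed.

Lemma fcoef_even_alternant m :
  fcoef (even_alternant x) m =
    \sum_(s : 'S_n) (-1) ^+ s * (even_chain 0 (fun k => m (s k)))%:R.
Proof.
rewrite /even_alternant fcoef_sum; apply: eq_bigr => s _.
by rewrite fcoef_signM -chain_seriesE.
Qed.

End EvenAlternantCoef.

(** * The constant term as a sum of determinants *)

Section ConstMorphism.
Variables (n : nat) (R : comNzRingType).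

Lemma fps_const_zmod : zmod_morphism (@fps_const n R).
Proof.
by move=> a b; apply: fps_eq => m; rewrite fcoefD fcoefN /=; case: eqP; rewrite ?subr0.
Qed.

Lemma fps_const_monoid : monoid_morphism (@fps_const n R).
Proof.
split=> [|a b]; first exact: fmon1.
by rewrite !fmon_const fmonM add0m.
Qed.

HB.instance Definition _ := GRing.isZmodMorphism.Build R (fps n R) (@fps_const n R) fps_const_zmod.
HB.instance Definition _ := GRing.isMonoidMorphism.Build R (fps n R) (@fps_const n R) fps_const_monoid.

End ConstMorphism.

Lemma prod_frac (A : comUnitRingType) (I : eqType) (r : seq I) (P : pred I) (a b c : I -> A) :
  (forall i, P i -> c i \is a GRing.unit) ->
  \prod_(i <- r | P i) (a i * b i / c i) =
    (\prod_(i <- r | P i) a i) * (\prod_(i <- r | P i) b i) / \prod_(i <- r | P i) c i.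
Proof. by move=> Uc; rewrite !big_split /= prodrV. Qed.

Lemma frac_shuffle (A : comUnitRingType) (a b c d e : A) :
  d \is a GRing.unit -> e \is a GRing.unit -> (a * b / d) * (c / e) = (b * c) * (a / (d * e)).
Proof. by move=> Ud Ue; rewrite invrM //; ring. Qed.

Section ConstantTermSum.
Variable N : nat.
Local Notation n := N.+1.
Local Notation T := {mpoly int[n]}.
Local Notation t := (fun k : nat => fps_const n (tvar n k)).
Local Notation x := (fps_var T : 'I_n -> fps n T).

Definition tpoly (j : nat) : {poly T} := \prod_(r < j.+1) (1 + tvar n r *: 'X).

(** The elementary symmetric polynomial of degree [2 * j - l] in [t 0, ..., t j]. *)
Definition tcoef (j l : nat) : T := if (l <= 2 * j)%N then (tpoly j)`_(2 * j - l) else 0.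

Lemma size_tpoly j : (size (tpoly j) <= j.+2)%N.
Proof.
rewrite /tpoly; elim: j.+1 => [|k IHk]; first by rewrite big_ord0 size_poly1.
rewrite big_ord_recr /= mulrDr mulr1.
rewrite (leq_trans (size_polyD _ _)) // geq_max ltnW //= -scalerAr.
by rewrite (leq_trans (size_scale_leq _ _)) // (leq_trans (size_polyMleq _ _)) // size_polyX addn2.
Qed.

Lemma horner_tpoly (j : nat) (u : fps n T) :
  (map_poly (@fps_const n T) (tpoly j)).[u] = \prod_(r < j.+1) (1 + t r * u).
Proof.
rewrite rmorph_prod horner_prod; apply: eq_bigr => r _.
by rewrite rmorphD rmorph1 /= map_polyZ /= map_polyX hornerD hornerC hornerZ hornerX.
Qed.

(** The factors in the [t k] are gathered by the variable that they involve. *)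
Lemma constant_term_series :
  (\prod_(i < n) \prod_(j < n | (i < j)%N)
     ((x j - x i) * (1 + t i.+1 * x j) / (1 - x i * x j))) *
  \prod_(i < n) ((1 + t 0%N * x i) / (1 - x i ^+ 2))
  = (\prod_(j < n) (map_poly (@fps_const n T) (tpoly j)).[x j]) * even_alternant x.
Proof.
have U2 i j : 1 - x i * x j \is a GRing.unit.
  by apply: unit_sub1; rewrite fcoefM0 fmon_var /=; case: eqP => [/(congr1 mdeg)|_]; rewrite ?mdeg0 ?mdeg1 // mul0r.
have Upair : pair_prod x \is a GRing.unit.
  by apply: rpred_prod => i _; apply: rpred_prod => j _.
have -> : even_alternant x = vander x / pair_prod x.
  apply: (canRL (mulrK Upair)); apply: even_littlewood => -[//|i r] _.
  by rewrite big_cons; apply/unit_sub1/fcoef0_varM.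
have -> : pair_prod x = (\prod_(i < n) \prod_(j < n | (i < j)%N) (1 - x i * x j)) *
    \prod_(i < n) (1 - x i ^+ 2).
  rewrite -big_split; apply: eq_bigr => i _; rewrite (bigD1 i) //= mulrC expr2.
  by congr (_ * _); apply: eq_bigl => j; rewrite [RHS]ltn_neqAle -val_eqE andbC eq_sym.
have -> : \prod_(j < n) (map_poly (@fps_const n T) (tpoly j)).[x j] =
    (\prod_(i < n) \prod_(j < n | (i < j)%N) (1 + t i.+1 * x j)) *
    \prod_(i < n) (1 + t 0%N * x i).
  have -> : \prod_(i < n) \prod_(j < n | (i < j)%N) (1 + t i.+1 * x j) =
      \prod_(j < n) \prod_(i < n | (i < j)%N) (1 + t i.+1 * x j).
    by rewrite (exchange_big_dep xpredT).
  rewrite -big_split; apply: eq_bigr => j _ /=.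
  rewrite horner_tpoly big_ord_recl mulrC; congr (_ * _).
  by rewrite (big_ord_widen n (fun i => 1 + t i.+1 * x j)) // ltnW.
rewrite (eq_bigr _ (fun i _ => prod_frac _ _ _ (fun j _ => U2 i j))).
rewrite prod_frac => [|i _]; last by apply: rpred_prod => j _.
rewrite big_split /= prodrV => [|i _]; last by rewrite expr2.
apply: frac_shuffle; last by apply: rpred_prod => i _; rewrite expr2.
by apply: rpred_prod => i _; apply: rpred_prod => j _.
Qed.

(** The coefficient is a sum over an exponent sequence and a permutation acting on
    it; moving the permutation to the coefficients [tcoef] turns the inner sum into
    a determinant. *)
Lemma constant_term_sum :
  CT (laurent_shift [ffun i : 'I_n => - (2 * i)%N%:Z]
       (laurent_of_fps
         ((\prod_(i < n) \prod_(j < n | (i < j)%N)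
             ((x j - x i) * (1 + t i.+1 * x j) / (1 - x i * x j))) *
          \prod_(i < n) ((1 + t 0%N * x i) / (1 - x i ^+ 2)))))
  = \sum_(m : {ffun 'I_n -> 'I_(2 * n)} | even_chain 0 (fun k => m k))
      \det (\matrix_(j, k) tcoef j (m k)).
Proof.
rewrite constant_term_series /CT /laurent_shift /laurent_of_fps.
have eE (i : 'I_n) : (0 - [ffun i : 'I_n => - (2 * i)%N%:Z] : {ffun 'I_n -> int}) i = (2 * i)%N%:Z.
  by rewrite !ffunE sub0r opprK.
rewrite ifT; last by apply/forallP => i; rewrite eE.
rewrite (_ : [multinom _ | i < n] = [multinom (2 * i)%N | i < n]); last first.
  by apply/mnmP => i; rewrite !mnmE eE.
rewrite (@fcoef_prod_horner _ _ (2 * n)); last first.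
- by move=> j; have := ltn_ord j; lia.
- by move=> j; apply: leq_trans (size_tpoly _) _; have := ltn_ord j; lia.
under eq_bigr => m _.
  rewrite fcoef_even_alternant big_distrr /=.
  over.
rewrite exchange_big /=.
pose act (s : 'S_n) (m : {ffun 'I_n -> 'I_(2 * n)}) : {ffun 'I_n -> 'I_(2 * n)} :=
  [ffun k => m (s k)].
rewrite [RHS]big_mkcond /=.
transitivity (\sum_(m : {ffun 'I_n -> 'I_(2 * n)}) \sum_(s : 'S_n)
    (-1) ^+ s * (even_chain 0 (fun k => m k))%:R * \prod_k tcoef (s k) (m k)).
  rewrite [RHS]exchange_big; apply: eq_bigr => s _.
  have actK : cancel (act s^-1%g) (act s).
    by move=> m; apply/ffunP => k; rewrite !ffunE permK.
  rewrite (reindex_inj (can_inj actK)); apply: eq_bigr => m _ /=.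
  rewrite mulrC; congr (_ * (_ %:R) * _).
    by congr even_chain; apply: boolp.funext => k; rewrite mnmE ffunE permK.
  rewrite (reindex_inj (@perm_inj _ s)); apply: eq_bigr => k _.
  by rewrite ffunE permK.
apply: eq_bigr => m _; case: ifP => _; last first.
  by apply: big1 => s _; rewrite mulr0 mul0r.
rewrite -det_tr; apply: eq_bigr => s _; rewrite mulr1; congr (_ * _).
by apply: eq_bigr => k _; rewrite !mxE.
Qed.

End ConstantTermSum.

(** * The Schubert polynomials of the statement *)

Section SchubertEval.
Variable N : nat.
Local Notation n := N.+1.
Local Notation T := {mpoly int[n]}.
Implicit Type la : {ffun 'I_N -> nat}.

(** The evaluation of polynomials in one more letter than the alphabet has,
    the additional letter being zero. *)
Definition ev : {mpoly T[(2 * N).+1]} -> T :=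
  meval (@ybar n) \o comp_mpoly (drop_last_letter (2 * N) T).

HB.instance Definition _ := GRing.RMorphism.on ev.

Lemma evX (p : 'I_(2 * N).+1) : (0 < N)%N ->
  ev 'X_p = if p == 0%N :> nat then tvar n 0 else if odd p then tvar n p.+1./2 else 0.
Proof.
move=> N0; rewrite /ev /=; case: (unliftP ord_max p) => [q|] ->.
  by rewrite drop_last_X mevalXU /ybar lift_max.
rewrite drop_last_X0 meval0 /=.
have -> : (2 * N == 0)%N = false by lia.
by rewrite oddM.
Qed.

(** The letters at even positions, counted from zero, vanish except for the first
    one, so that each of [t 0, ..., t j] occurs once among the first [2 * j] letters. *)
Lemma ev_flag_gen j : (0 < j <= N)%N -> map_poly ev (flag_gen (2 * N).+1 T (2 * j)) = tpoly N j.
Proof.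
have gen0 : flag_gen (2 * N).+1 T 0 = 1 by rewrite /flag_gen big_pred0.
have step (p : 'I_(2 * N).+1) : map_poly ev (flag_gen (2 * N).+1 T p.+1) =
    map_poly ev (flag_gen (2 * N).+1 T p) * (1 + ev 'X_p *: 'X).
  by rewrite flag_gen_recr rmorphM rmorphD rmorph1 /= map_polyZ /= map_polyX.
case: j => // j /= ltj; have N0 : (0 < N)%N by apply: leq_ltn_trans ltj.
elim: j ltj => [|j IHj] ltj.
  have lt0 : (0 < (2 * N).+1)%N by [].
  have lt1 : (1 < (2 * N).+1)%N by lia.
  rewrite (step (Ordinal lt1)) (step (Ordinal lt0)) !evX //= gen0 rmorph1 mul1r.
  by rewrite /tpoly 2!big_ord_recl big_ord0 mulr1.
have lt0 : (2 * j.+1 < (2 * N).+1)%N by lia.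
have lt1 : ((2 * j.+1).+1 < (2 * N).+1)%N by lia.
have -> : (2 * j.+2 = (2 * j.+1).+2)%N by lia.
have e0 : ev 'X_(Ordinal lt0) = 0.
  by rewrite evX // [nat_of_ord _]/= muln_eq0 oddM.
have e1 : ev 'X_(Ordinal lt1) = tvar n j.+2.
  have odd_p : odd (2 * j.+1).+1 by rewrite oddS oddM.
  have half_p : ((2 * j.+1).+2./2 = j.+2)%N by lia.
  by rewrite evX // [nat_of_ord _]/= odd_p half_p.
rewrite (step (Ordinal lt1)) (step (Ordinal lt0)) e0 e1 IHj 1?ltnW //.
by rewrite [RHS]/tpoly big_ord_recr /= scale0r addr0 mulr1.
Qed.

Lemma ev_elem_diff (j l : nat) : (j <= N)%N ->
  ev (elem_diff (2 * N).+1 T (2 * j) l) = tcoef N j l.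
Proof.
move=> le_jN; rewrite /elem_diff /tcoef; case: ifP => [le_l|_]; last exact: rmorph0.
rewrite -coef_map; case: j le_jN le_l => [_ _|j le_jN _]; last by rewrite ev_flag_gen.
have -> : flag_gen (2 * N).+1 T (2 * 0) = 1 by rewrite /flag_gen big_pred0.
by rewrite rmorph1 coef1 /tpoly big_ord1 coefD coef1 coefZ coefX mulr0 addr0.
Qed.

(** The exponents of the alternant of the partition [la], seen as a partition
    with a further part zero. *)
Definition exponents la (k : 'I_n) : nat :=
  if unlift ord0 k is Some i then (i.+1 + la (rev_ord i))%N else 0%N.

Lemma exponents0 la : exponents la ord0 = 0%N.
Proof. by rewrite /exponents unlift_none. Qed.

Lemma exponentsS la i : exponents la (lift ord0 i) = (i.+1 + la (rev_ord i))%N.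
Proof. by rewrite /exponents liftK. Qed.

Lemma partP la : reflect (forall a b : 'I_N, (a <= b)%N -> (la b <= la a)%N) (is_part la).
Proof.
apply: (iffP idP) => [part_la a b|mono].
  by have /forallP/(_ a)/forallP/(_ b)/implyP := part_la.
by apply/'forall_forallP => a b; apply/implyP; apply: mono.
Qed.

Lemma exponents_increasing la : is_part la -> increasing (exponents la).
Proof.
move=> /partP part_la a b; case: (unliftP ord0 b) => [b'|] -> //.
case: (unliftP ord0 a) => [a'|] ->; rewrite ?exponents0 !exponentsS ?lift0 //.
rewrite ltnS => ltab.
have := part_la (rev_ord b') (rev_ord a'); rewrite /=; lia.
Qed.

Lemma exponents_le la : subpart la (rho n) -> forall k, (exponents la k <= 2 * k)%N.
Proof.
move=> /forallP sub k; case: (unliftP ord0 k) => [i|] ->; rewrite ?exponents0 //.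
have := sub (rev_ord i); rewrite exponentsS ffunE lift0 /=; have := ltn_ord i; lia.
Qed.

(** The entry number [2 * k] of the code counts the parts of [rho] that are at least
    [k] while the corresponding part of [la] is smaller; since [la] is contained in
    [rho], these are [n - k] parts without the [conj_part la k] parts of [la]. *)
Lemma flag_code_rho la (p : 'I_(2 * N)) : subpart la (rho n) ->
  flag_code (2 * N).+1 (fun j : 'I_n => 2 * j)%N (exponents la) (lift ord_max p) = @rho_quot n la p.
Proof.
move=> sub; rewrite !ffunE; case: ifP => [/existsP[j /eqP]|].
  by rewrite lift_max => <-; rewrite oddM.
rewrite lift_max => /existsPn ne.
have odd_p : odd p.
  apply: contraT => ev_p; have ltj : (p./2 < n)%N by have := ltn_ord p; lia.
  by have := ne (Ordinal ltj); rewrite /= mul2n even_halfK ?eqxx.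
rewrite odd_p; set k := p.+1./2.
have pk : (p = 2 * k - 1 :> nat)%N by rewrite /k; move: odd_p; lia.
have k0 : (0 < k)%N by rewrite /k; move: odd_p; lia.
have ltk : (k < n)%N by have := ltn_ord p; lia.
clearbody k.
have -> : rank (fun j : 'I_n => 2 * j)%N (lift ord_max p) = k.
  rewrite /rank -[RHS](card_lt_ord (ltnW ltk)); apply: eq_card => a.
  by rewrite !inE lift_max /=; lia.
have -> : #|[set a : 'I_n | (p < 2 * a)%N && (exponents la a + k <= p + a)%N]| =
    #|[set i : 'I_N | (k <= i.+1)%N && (la (rev_ord i) < k)%N]|.
  rewrite -[RHS](card_imset _ (@lift_inj _ ord0)); apply: eq_card => a.
  rewrite !inE; apply/andP/imsetP => [[lt_p le_a]|[i]].
    case: (unliftP ord0 a) lt_p le_a => [i|] ->; last by rewrite muln0.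
    rewrite exponentsS lift0 /= => lt_p le_a; exists i => //.
    by rewrite inE; apply/andP; split; lia.
  by rewrite inE => /andP[le_k lt_k] ->; rewrite exponentsS lift0 /=; split; lia.
cbv zeta; have -> : conj_part la k = #|[set i : 'I_N | (k <= i.+1)%N && (k <= la (rev_ord i))%N]|.
  rewrite /conj_part -(card_imset _ (@rev_ord_inj N)); apply: eq_card => i.
  rewrite !inE; apply/imsetP/andP => [[i']|[le_k le_la]].
    rewrite inE => le_la ->; rewrite rev_ordK; split=> //.
    by have /forallP/(_ i') := sub; rewrite ffunE /=; have := ltn_ord i'; lia.
  by exists (rev_ord i); rewrite ?rev_ordK ?inE.
suff -> : (n - k = #|[set i : 'I_N | (k <= i.+1)%N && (la (rev_ord i) < k)%N]| +
    #|[set i : 'I_N | (k <= i.+1)%N && (k <= la (rev_ord i))%N]|)%N by rewrite addnK.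
have -> : (n - k = #|[set i : 'I_N | (k <= i.+1)%N]|)%N.
  have -> : [set i : 'I_N | (k <= i.+1)%N] = ~: [set i : 'I_N | (i < k.-1)%N].
    by apply/setP => i; rewrite !inE; lia.
  rewrite cardsCs setCK card_ord.
  have lek : (k.-1 <= N)%N by lia.
  by rewrite (card_lt_ord lek); lia.
rewrite -(cardsID [set i : 'I_N | (la (rev_ord i) < k)%N]); congr (_ + _)%N.
  by apply: eq_card => i; rewrite !inE.
by apply: eq_card => i; rewrite !inE -leqNgt andbC.
Qed.

Lemma schubert_eval la : (0 < N)%N -> is_part la -> subpart la (rho n) ->
  (schubert (fun=> 0 : T) (rho_quot (n := n) la)).@[@ybar n] =
    \det (\matrix_(j < n, k < n) tcoef N j (exponents la k)).
Proof.
move=> N0 part_la sub.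
pose f (j : 'I_n) := (2 * j)%N.
have incf : increasing f by move=> a b; rewrite /f; lia.
have codeS : schubert (fun=> 0 : T) (rho_quot (n := n) la) =
    comp_mpoly (drop_last_letter (2 * N) T)
      (schubert (fun=> 0) (flag_code (2 * N).+1 f (exponents la))).
  rewrite (@schubert_drop_last _ _ _ _ (rho_quot (n := n) la)) //.
    by apply: (flag_code0 _ (a := ord_max)).
  by move=> k; rewrite flag_code_rho.
rewrite codeS (@schubert_flag _ _ _ ord_max) //; first last.
- by move=> a; rewrite /f /=; have := ltn_ord a; lia.
- exact: exponents_le.
- exact: exponents_increasing.
rewrite -[LHS]/(ev _) /flag_det -det_map_mx; congr (\det _); apply/matrixP => j k.
by rewrite !mxE; apply: ev_elem_diff; rewrite -ltnS.
Qed.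

Lemma det_tcoef0 (m : 'I_n -> nat) : even_chain 0 m -> ~~ [forall k : 'I_n, (m k <= 2 * k)%N] ->
  \det (\matrix_(j < n, k < n) tcoef N j (m k)) = 0.
Proof.
case/even_chainP => Hm mono; rewrite negb_forall => /existsP[r lt_r].
apply: (det_zero_block (r := r)) => j k le_j le_k; rewrite mxE /tcoef ifN //.
by have := mono r k le_k; have [] := Hm r; have [] := Hm k; lia.
Qed.

Lemma even_chain_exponents la :
  even_chain 0 (exponents la) && [forall k : 'I_n, (exponents la k <= 2 * k)%N] =
  [&& is_part la, subpart la (rho n) & even_part la].
Proof.
apply/andP/and3P => [[/even_chainP[Hl mono] /forallP le2]|[part_la sub ev_la]].
  have laE i : exponents la (lift ord0 (rev_ord i)) = ((rev_ord i).+1 + la i)%N.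
    by rewrite exponentsS rev_ordK.
  split.
  - apply/partP => a b le_ab.
    have le_ba : (lift ord0 (rev_ord b) <= lift ord0 (rev_ord a))%N.
      by rewrite !lift0 /=; lia.
    by have := mono _ _ le_ba; rewrite !laE !lift0 !addKn.
  - apply/forallP => i; have := le2 (lift ord0 (rev_ord i)).
    by rewrite laE lift0 ffunE /=; have := ltn_ord i; lia.
  apply/forallP => i; have [_ + _] := Hl (lift ord0 (rev_ord i)).
  by rewrite laE lift0 addKn.
split; last by apply/forallP; apply: exponents_le.
have {}part_la := partP la part_la.
apply/even_chainP; split=> [k|a b].
  case: (unliftP ord0 k) => [i|] ->; rewrite ?exponents0 ?exponentsS ?lift0 ?subnn //.
  by rewrite leq_addr addKn; split=> //; exact: (forallP ev_la).
case: (unliftP ord0 a) => [a'|] ->; rewrite ?exponents0 ?exponentsS // !lift0 addKn.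
case: (unliftP ord0 b) => [b'|] ->; rewrite ?exponents0 ?exponentsS // !lift0 addKn.
by move=> le_ab; apply: part_la; rewrite /=; lia.
Qed.

End SchubertEval.

Theorem theorem5 (n : nat) (hn : (2 <= n)%N) :
  let t (k : nat) : fps n {mpoly int[n]} := fps_const n (tvar n k) in
  let x (i : 'I_n) : fps n {mpoly int[n]} := fps_var _ i in
  CT (laurent_shift [ffun i : 'I_n => - (2 * i)%N%:Z]
       (laurent_of_fps
         ((\prod_(i < n) \prod_(j < n | (i < j)%N)
             ((x j - x i) * (1 + t i.+1 * x j) / (1 - x i * x j))) *
          \prod_(i < n) ((1 + t 0%N * x i) / (1 - x i ^+ 2)))))
  = \sum_(la : {ffun 'I_n.-1 -> 'I_n} |
             [&& is_part (bounded_part la),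
                 subpart (bounded_part la) (rho n)
               & even_part (bounded_part la)])
      (schubert (fun _ => 0) (rho_quot (bounded_part la))).@[@ybar n].
Proof.
case: n hn => // N N0 t x; rewrite [LHS]constant_term_sum.
rewrite (bigID (fun m : {ffun 'I_N.+1 -> 'I_(2 * N.+1)} => [forall k : 'I_N.+1, (m k <= 2 * k)%N])) /=.
rewrite [X in _ + X]big1 ?addr0 => [|m /andP[]]; last exact: det_tcoef0.
have lt_exp (la : {ffun 'I_N -> 'I_N.+1}) k : (exponents (bounded_part (n := N.+1) la) k < 2 * N.+1)%N.
  case: (unliftP ord0 k) => [i|] ->; rewrite ?exponents0 ?exponentsS //.
  by rewrite ffunE; move: (ltn_ord (la (rev_ord i))) (ltn_ord i) => /=; lia.
pose h (la : {ffun 'I_N -> 'I_N.+1}) : {ffun 'I_N.+1 -> 'I_(2 * N.+1)} :=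
  [ffun k => Ordinal (lt_exp la k)].
pose h' (m : {ffun 'I_N.+1 -> 'I_(2 * N.+1)}) : {ffun 'I_N -> 'I_N.+1} :=
  [ffun i => inord (m (lift ord0 (rev_ord i)) - (rev_ord i).+1)].
have hE la : (fun k => h la k : nat) = exponents (bounded_part (n := N.+1) la).
  by apply: boolp.funext => k; rewrite ffunE.
have hK la : h' (h la) = la.
  apply/ffunP => i; rewrite !ffunE /= exponentsS rev_ordK addKn ffunE.
  exact: inord_val.
rewrite (reindex_onto h h') => [|m /andP[/even_chainP[Hm mono] /forallP le2]]; last first.
  apply/ffunP => k; apply: val_inj; rewrite ffunE /=.
  case: (unliftP ord0 k) => [i|] ->; last first.
    by rewrite exponents0; have := le2 ord0; rewrite leqn0 => /eqP.
  rewrite exponentsS !ffunE rev_ordK /=.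
  have [le_m _ _] := Hm (lift ord0 i); have := le2 (lift ord0 i).
  move: le_m; rewrite lift0 => le_m le_2; rewrite inordK ?subnKC //.
  by move: (ltn_ord i) le_2 le_m => /=; lia.
apply: eq_big => [la|la]; rewrite hE.
  rewrite hK eqxx andbT -even_chain_exponents; congr (_ && _).
  by apply: eq_forallb => k; rewrite ffunE.
case/andP=> /andP[ch le2] _.
have : [&& is_part (bounded_part (n := N.+1) la), subpart (bounded_part (n := N.+1) la) (rho N.+1) & even_part (bounded_part (n := N.+1) la)].
  rewrite -even_chain_exponents ch; apply/forallP => k.
  by have := forallP le2 k; rewrite ffunE.
case/and3P=> part_la sub _.
rewrite [RHS](@schubert_eval N (bounded_part (n := N.+1) la)) //.
by congr (\det _); apply/matrixP => j k; rewrite !mxE ffunE.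
Qed.
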